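(* Let $(\theta_1,\dots,\theta_n)$ with $n\ge3$ be a finite cyclic sequence of angles with $0\le\theta_i\le\pi$ for all $i$, and suppose the sequence is not a permutation of $(0,0,\pi)$. Then there is a simple arc-polygon with $n$ vertices whose interior angles, in cyclic order around the polygon, are $\theta_1,\dots,\theta_n$.
   Context: An arc-polygon is a cyclic sequence alternating between points (vertices) and closed circular arcs (edges) in the Euclidean plane, each arc appearing consecutively with its two endpoints; straight line segments count as degenerate circular arcs. It is simple if the only intersection points between pairs of its edges are shared vertices consecutive with both edges; its edges then form a Jordan curve bounding an interior. The interior angle at a vertex is the angle between the tangent lines of its two incident arcs at that vertex, measured through the interior of the polygon near the vertex. *)

(* Defs.v *)
From HB Require Import structures.
From mathcomp Require Import all_boot all_order all_algebra.
From mathcomp Require Import all_classical all_reals all_analysis.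
Set Implicit Arguments. Unset Strict Implicit. Unset Printing Implicit Defensive.
Import Order.TTheory GRing.Theory Num.Theory.
Import numFieldNormedType.Exports.
Local Open Scope classical_set_scope.
Local Open Scope ring_scope.

Section ArcPolygon.
Variable R : realType.
Notation pt := (R * R)%type.

Definition padd (x y : pt) : pt := (x.1 + y.1, x.2 + y.2).
Definition psub (x y : pt) : pt := (x.1 - y.1, x.2 - y.2).
Definition pscale (k : R) (x : pt) : pt := (k * x.1, k * x.2).
Definition rot (a : R) (x : pt) : pt :=
  (cos a * x.1 - sin a * x.2, sin a * x.1 + cos a * x.2).

(* A closed circular arc (possibly a segment) from p to q, p != q, is
   determined by the signed angle a in (-pi, pi) between the chord q - p and
   the arc; its tangent direction at p is rot (-a) (q - p) and at q is
   rot a (q - p).  a = 0 gives the straight segment.  Parametrization: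
   z(t) = p + c(t) * rot (a (t - 1)) (q - p), t in [0,1],
   c(t) = sin (a t) / sin a  (c(t) = t when a = 0). *)
Definition arc_coef (a t : R) : R := if a == 0 then t else sin (a * t) / sin a.
Definition arc_point (p q : pt) (a t : R) : pt :=
  padd p (pscale (arc_coef a t) (rot (a * (t - 1)) (psub q p))).
Definition arc_set (p q : pt) (a : R) : set pt :=
  [set arc_point p q a t | t in `[0, 1]%classic].

Definition nxt (n : nat) (i : 'I_n) : 'I_n := ordS i.
Definition prv (n : nat) (i : 'I_n) : 'I_n := ord_pred i.

Definition edge n (v : 'I_n -> pt) (a : 'I_n -> R) (i : 'I_n) : set pt :=
  arc_set (v i) (v (nxt i)) (a i).

Definition curve n (v : 'I_n -> pt) (a : 'I_n -> R) : set pt :=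
  \bigcup_(i in [set: 'I_n]) edge v a i.

Definition well_formed n (v : 'I_n -> pt) (a : 'I_n -> R) : Prop :=
  forall i, v i != v (nxt i) /\ - pi < a i < pi.

Definition simple n (v : 'I_n -> pt) (a : 'I_n -> R) : Prop :=
  well_formed v a /\
  forall i j : 'I_n, i != j -> forall z, edge v a i z -> edge v a j z ->
    (j = nxt i /\ z = v j) \/ (i = nxt j /\ z = v i).

Definition bounded_pt (S : set pt) : Prop :=
  exists M : R, forall z, S z -> `|z.1| <= M /\ `|z.2| <= M.

Definition interior_of n (v : 'I_n -> pt) (a : 'I_n -> R) : set pt :=
  [set z | ~ curve v a z /\ bounded_pt (connected_component (~` curve v a) z)].
Definition exterior_of n (v : 'I_n -> pt) (a : 'I_n -> R) : set pt :=
  [set z | ~ curve v a z /\ ~ interior_of v a z].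

Definition ray_eventually (S : set pt) (x d : pt) : Prop :=
  exists eps : R, 0 < eps /\ forall t, 0 < t < eps -> S (padd x (pscale t d)).

(* tangent direction at v i of the outgoing edge i, and of the incoming edge
   (prv i), pointing away from v i along that edge *)
Definition tan_out n (v : 'I_n -> pt) (a : 'I_n -> R) (i : 'I_n) : pt :=
  rot (- a i) (psub (v (nxt i)) (v i)).
Definition tan_in n (v : 'I_n -> pt) (a : 'I_n -> R) (i : 'I_n) : pt :=
  pscale (-1) (rot (a (prv i)) (psub (v i) (v (prv i)))).

(* theta is the interior angle at vertex v i: the angle in [0, 2pi] swept,
   in one rotational sense s, from the tangent of one incident arc to the
   tangent of the other, through the interior of the polygon *)
Definition interior_angle n (v : 'I_n -> pt) (a : 'I_n -> R) (i : 'I_n)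
    (theta : R) : Prop :=
  0 <= theta <= 2 * pi /\
  exists s : R, (s = 1 \/ s = -1) /\
    (exists k : R, 0 < k /\ rot (s * theta) (tan_out v a i) = pscale k (tan_in v a i)) /\
    (forall phi, 0 < phi < theta ->
       ray_eventually (interior_of v a) (v i) (rot (s * phi) (tan_out v a i))) /\
    (forall phi, theta < phi < 2 * pi ->
       ray_eventually (exterior_of v a) (v i) (rot (s * phi) (tan_out v a i))).

End ArcPolygon.

(* Main.v *)
From HB Require Import structures.
From mathcomp Require Import all_boot all_order all_algebra.
From mathcomp Require Import all_classical all_reals all_analysis.
From mathcomp Require Import ring lra zify.
Require Import Defs.
Import Order.TTheory GRing.Theory Num.Theory.
Import numFieldNormedType.Exports.
Local Open Scope classical_set_scope.
Local Open Scope ring_scope.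

(* Except for n = 4 and the angles (0, pi, 0, pi), the polygon can be taken
   star-shaped about the origin.  Split each angle as theta_i = p_i + q_i, the
   radius through the i-th vertex being the dividing line, and let the i-th edge
   subtend the angle 2 c_i at the origin.  In the triangle spanned by the origin
   and this edge the chord is tilted by d_i = (p_i - q_(i+1)) / 2, so that
   consecutive radii have ratio cos (c_i - d_i) / cos (c_i + d_i).  The polygon
   closes up iff sum c_i = pi and the product of these ratios is 1, with
   0 < c_i < pi/2 - |d_i|.  If sum d_i = 0 and sum |d_i| < (n - 2) pi / 2 such c_i
   exist by the intermediate value theorem: the product minus its target has
   opposite signs at two configurations in which a sector with d_i > 0,
   respectively d_i < 0, has the extremal width c_i = pi/2 - |d_i|.  Bisecting all
   angles meets the condition unless n = 3 and {0, pi} is contained in the angles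
   (where an explicit unequal splitting works) or n = 4 and the angles alternate.

   Along every edge the polar angle is strictly increasing, so each ray from the
   origin meets the curve exactly once.  The points before and after the hit form
   relatively clopen parts of the complement of the curve, the first one bounded,
   the second one escaping along rays; this identifies the interior and exterior
   without the Jordan curve theorem.

   For (0, pi, 0, pi) the polygon bounds a crescent between two S-curves made
   of quarter circles over the chords [0,1], [1,3] and [0,2], [2,3] of the x-axis. *)

Set Implicit Arguments. Unset Strict Implicit. Unset Printing Implicit Defensive.

(** * Separating the plane by a curve *)

Section Separation.
Variable R : realType.
Implicit Types (C U V K : set (R * R)).

Lemma continuous_pair (T : topologicalType) (f g : T -> R) :
  continuous f -> continuous g -> continuous (fun x => (f x, g x)).
Proof. by move=> cf cg x; apply: (@cvg_pair _ _ _ (nbhs x) (nbhs (f x)) (nbhs (g x)));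
  [exact: cf|exact: cg]. Qed.

Lemma continuous_padd_pscale (z d : R * R) :
  continuous (fun t => padd z (pscale t d)).
Proof.
have aff (u w : R) : continuous (fun t : R => u + t * w).
  move=> t; apply: (@continuousD _ R R (fun=> u) (fun t => t * w)).
    exact: cst_continuous.
  by apply: continuousM; [exact: cvg_id|exact: cst_continuous].
by apply: continuous_pair; exact: aff.
Qed.

(** The trace of [U] on [K] is cut out both by the open complement of [V] and [C] and by the closed
    union of [U] and [C]. Being clopen and nonempty, it is all of [K]. *)
Lemma connected_sub_clopen C U V K :
  (forall z, U z \/ C z \/ V z) -> (forall z, U z -> ~ C z /\ ~ V z) ->
  closed (U `|` C) -> closed (V `|` C) -> connected K -> K `<=` ~` C ->
  forall z, K z -> U z -> K `<=` U.
Proof.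
move=> cov dis cUC cVC Kc KC z Kz Uz.
suff <- : K `&` U = K by move=> x [].
apply: Kc; first by exists z.
- exists (~` (V `|` C)); first exact: closed_openC.
  apply/seteqP; split => x [Kx] /=.
    by move=> /dis[nC nV]; split=> //; case.
  by have [//|[Cx|Vx]] := cov x => nVC; case: nVC; [right|left].
- exists (U `|` C) => //; apply/seteqP; split => x [Kx].
    by move=> Ux; split=> //; left.
  by case=> // Cx; case: (KC x Kx).
Qed.

(** A ray inside [V] is connected and unbounded, which makes the component of its origin
    unbounded. *)
Definition escaping (V : set (R * R)) (z : R * R) :=
  exists d : R * R, d <> (0, 0) /\ forall t, 0 <= t -> V (padd z (pscale t d)).

Lemma connected_ray (z d : R * R) :
  connected [set padd z (pscale t d) | t in [set t | 0 <= t]].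
Proof.
apply: connected_continuous_connected.
  by apply/connected_intervalP => a b /= a0 b0 c /andP[ac _]; exact: le_trans ac.
by apply: continuous_subspaceT; exact: continuous_padd_pscale.
Qed.

Lemma ray_unbounded (z d : R * R) : d <> (0, 0) ->
  ~ bounded_pt [set padd z (pscale t d) | t in [set t | 0 <= t]].
Proof.
case: z d => z1 z2 [d1 d2] d0 [M HM].
(* Some coordinate of [d] is nonzero, and the ray is affine in it. At the chosen parameter the
   variable part exceeds the bound even after the constant [u] is subtracted. *)
have key (u w : R) : w != 0 -> ~ (forall t, 0 <= t -> `|u + t * w| <= M).
  move=> w0 /(_ ((`|M| + `|u| + 1) / `|w|)) H.
  have wp : 0 < `|w| by rewrite normr_gt0.
  have t0 : 0 <= (`|M| + `|u| + 1) / `|w|.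
    by rewrite divr_ge0 // !addr_ge0.
  have := H t0; set x := _ * w.
  have nx : `|x| = `|M| + `|u| + 1.
    rewrite normrM (ger0_norm t0) divfK // gt_eqF //.
  have := ler_normB (u + x) u; rewrite addrAC subrr add0r nx.
  have := ler_norm M; lra.
have [d10|] := eqVneq d1 0; last first.
  move=> /(key z1); apply=> t t0.
  by have [] := HM (padd (z1, z2) (pscale t (d1, d2))) _; first by exists t.
have d20 : d2 != 0.
  by apply/eqP => d2E; apply: d0; rewrite d10 d2E.
apply: (key z2 _ d20) => t t0.
by have [] := HM (padd (z1, z2) (pscale t (d1, d2))) _; first by exists t.
Qed.

(** A component meeting [U] stays in the bounded set [U], while the component of a point of [V]
    contains an escaping ray. So any explicit pair of regions of this kind identifies interior and
    exterior. *)
Lemma separated_components n (v : 'I_n -> R * R) (a : 'I_n -> R) U V :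
  let C := curve v a in
  (forall z, U z \/ C z \/ V z) -> (forall z, U z -> ~ C z /\ ~ V z) ->
  (forall z, V z -> ~ C z) ->
  closed (U `|` C) -> closed (V `|` C) -> bounded_pt U ->
  (forall z, V z -> escaping V z) ->
  U `<=` interior_of v a /\ V `<=` exterior_of v a.
Proof.
move=> C cov dUCV dVC cU cV [M bU] esc; split=> z Hz.
  have nC : ~ C z by case: (dUCV z Hz).
  split=> //; exists M => x Kx; apply: bU.
  apply: (connected_sub_clopen cov dUCV cU cV _ _ _ Hz Kx).
  - exact: component_connected.
  - exact: connected_component_sub.
  - exact: connected_component_refl.
split; first exact: dVC.
move=> [_ [N bN]].
have [d [d0 Hd]] := esc z Hz.
apply: (ray_unbounded (z := z) d0); exists N => x xr; apply: bN.
move: x xr; apply: connected_component_max.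
- exists 0 => //=; case: (z) (d) => z1 z2 [d1 d2].
  by rewrite /padd /pscale /= !mul0r !addr0.
- by move=> _ [t t0 <-]; apply: dVC; exact: Hd.
- exact: connected_ray.
Qed.

Lemma continuous_pscale :
  continuous (fun x : R * (R * R) => pscale x.1 x.2).
Proof.
apply: continuous_pair => x.
- apply: (@continuousM R _ fst (fun x : R * (R * R) => x.2.1)).
    exact: cvg_fst.
  by apply: (@continuous_comp _ _ _ snd fst); [exact: cvg_snd|exact: cvg_fst].
- apply: (@continuousM R _ fst (fun x : R * (R * R) => x.2.2)).
    exact: cvg_fst.
  by apply: (@continuous_comp _ _ _ snd snd); exact: cvg_snd.
Qed.

(** The cone over [K] from the origin is a continuous image of a product of two compact sets. *)
Lemma compact_cone K : compact K ->
  closed [set pscale l p | l in `[0, 1]%classic & p in K].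
Proof.
move=> cK.
apply: compact_closed; first exact: norm_hausdorff.
have -> : [set pscale l p | l in `[0, 1]%classic & p in K] =
  [set (fun x : R * (R * R) => pscale x.1 x.2) x | x in `[0, 1]%classic `*` K].
  apply/seteqP; split => z /=.
    by move=> [l l01 [p Kp <-]]; exists (l, p).
  by move=> [[l p] [/= l01 Kp] <-]; exists l => //; exists p.
apply: continuous_compact; last first.
  by apply: compact_setX => //; exact: segment_compact.
by apply: continuous_subspaceT; exact: continuous_pscale.
Qed.

(** The multiplier is the inverse of the dilation factor, so it ranges over a compact interval
    although the shadow is unbounded. The tube lemma then makes the complement open. *)
Lemma shadow_closed K : closed K ->
  closed [set z | exists2 m, 0 <= m <= 1 & K (pscale m z)].
Proof.
move=> cK; rewrite -openC openE => z /= nz; rewrite /interior /=.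
have /compact_near_coveringP nc := @segment_compact R 0 1.
pose f := fun x : R * (R * R) => pscale x.1 x.2.
have H : forall m : R, `[0, 1]%classic m ->
    \forall m' \near m & z' \near z, ~ K (pscale m' z').
  move=> m m01.
  have nK : ~ K (pscale m z).
    by move=> Km; apply: nz; exists m => //; move: m01; rewrite /= in_itv.
  have : nbhs (f (m, z)) (~` K).
    by apply: open_nbhs_nbhs; split=> //; exact: closed_openC.
  move=> /(@continuous_pscale (m, z)); exact.
apply: filterS (nc _ (nbhs z) (fun z' m => ~ K (pscale m z')) _ H).
move=> z' Hz' [m m01 Km].
by apply: (Hz' m _ Km); rewrite /= in_itv.
Qed.

End Separation.

(** * Arcs in polar coordinates *)

Section Directions.
Variable R : realType.
Implicit Types (x y a t s r k : R) (u w z : R * R).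

Definition dir x : R * R := (cos x, sin x).
Definition cross u w : R := u.1 * w.2 - u.2 * w.1.

Lemma cross_dir r k x y :
  cross (pscale r (dir x)) (pscale k (dir y)) = r * k * sin (y - x).
Proof. by rewrite /cross /= sinB; ring. Qed.

Lemma crossDl u w z : cross (padd u w) z = cross u z + cross w z.
Proof. by rewrite /cross /=; ring. Qed.

Lemma crossDr u w z : cross z (padd u w) = cross z u + cross z w.
Proof. by rewrite /cross /=; ring. Qed.

Lemma crossZl k u w : cross (pscale k u) w = k * cross u w.
Proof. by rewrite /cross /=; ring. Qed.

Lemma crossZr k u w : cross u (pscale k w) = k * cross u w.
Proof. by rewrite /cross /=; ring. Qed.

Lemma crossC u w : cross w u = - cross u w.
Proof. by rewrite /cross; ring. Qed.

Lemma crossuu u : cross u u = 0.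
Proof. by rewrite /cross; ring. Qed.

Lemma pscaleA k r u : pscale k (pscale r u) = pscale (k * r) u.
Proof. by rewrite /pscale /= !mulrA. Qed.

Lemma pscale1 u : pscale 1 u = u.
Proof. by case: u => u1 u2; rewrite /pscale /= !mul1r. Qed.

Lemma rot_pscale_dir a k x : rot a (pscale k (dir x)) = pscale k (dir (a + x)).
Proof. by rewrite /rot /dir /pscale /= cosD sinD; congr (_, _); ring. Qed.

Lemma dirDpi x : dir (x + pi) = pscale (-1) (dir x).
Proof. by rewrite /dir /pscale /= cosDpi sinDpi !mulN1r. Qed.

Lemma dirD2pi x : dir (x + 2 * pi) = dir x.
Proof.
have -> : x + 2 * pi = x + pi + pi by ring.
by rewrite !dirDpi pscaleA mulrNN mulr1 pscale1.
Qed.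

Lemma dir_neq0 x : dir x <> (0, 0).
Proof.
move=> [cx sx]; have := cos2Dsin2 x; rewrite cx sx => /eqP.
by rewrite expr0n /= addr0 eq_sym oner_eq0.
Qed.

Lemma sin_eq0_small x : - pi < x < pi -> sin x = 0 -> x = 0.
Proof.
move=> /andP[x1 x2] sx; apply/eqP; rewrite eq_le; apply/andP; split.
  rewrite leNgt; apply/negP => xp.
  by have := @sin_gt0_pi _ x; rewrite xp x2 sx ltxx => /(_ isT).
rewrite leNgt; apply/negP => xn.
have := @sin_gt0_pi _ (- x); rewrite sinN sx oppr0 ltxx.
by rewrite oppr_gt0 xn ltrNl x1 => /(_ isT).
Qed.

Lemma arc_coef0 a : arc_coef a 0 = 0.
Proof. by rewrite /arc_coef; case: ifP => // _; rewrite mulr0 sin0 mul0r. Qed.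

Lemma sin_neq0_small a : - pi < a < pi -> a != 0 -> sin a != 0.
Proof. by move=> aI; apply: contra_neq; exact: sin_eq0_small. Qed.

Lemma arc_coef1 a : - pi < a < pi -> arc_coef a 1 = 1.
Proof.
move=> aI; rewrite /arc_coef; case: ifPn => // a0.
by rewrite mulr1 divff // sin_neq0_small.
Qed.

Lemma arc_coefN a t : arc_coef (- a) t = arc_coef a t.
Proof.
by rewrite /arc_coef oppr_eq0; case: ifP => // _; rewrite mulNr !sinN invrN mulrNN.
Qed.

Lemma arc_coef_gt0 a t : - pi < a < pi -> 0 < t <= 1 -> 0 < arc_coef a t.
Proof.
wlog a0 : a / 0 <= a => [W aI tI|/andP[_ a1] /andP[t0 t1]].
  have [a0|a0] := leP 0 a; first exact: W.
  by rewrite -arc_coefN W //; lra.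
rewrite /arc_coef; case: eqVneq => // an0.
have ap : 0 < a by rewrite lt_neqAle eq_sym an0.
rewrite divr_gt0 // sin_gt0_pi ?ap //.
by rewrite mulr_gt0 //=; nra.
Qed.

Lemma arc_coef_ge0 a t : - pi < a < pi -> 0 <= t <= 1 -> 0 <= arc_coef a t.
Proof.
move=> aI /andP[t0 t1]; have [->|tn0] := eqVneq t 0; first by rewrite arc_coef0.
by rewrite ltW // arc_coef_gt0 // t1 lt_neqAle eq_sym tn0 t0.
Qed.

Lemma sinM_arc_coef a t : - pi < a < pi -> sin a * arc_coef a t = sin (a * t).
Proof.
move=> aI; rewrite /arc_coef; case: eqVneq => [->|a0].
  by rewrite sin0 mul0r sin0.
by rewrite mulrC divfK // sin_neq0_small.
Qed.

(** Spherical interpolation: a sine wave is recovered from its values at both ends, with arc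
    coefficients as weights. For [a = 0] the weights are [1 - t] and [t]. *)
Lemma sin_arc_interp a t x : - pi < a < pi ->
  sin (x - a * t) = arc_coef a (1 - t) * sin x + arc_coef a t * sin (x - a).
Proof.
move=> aI; rewrite /arc_coef; case: eqVneq => [->|a0].
  by rewrite mul0r !subr0; ring.
have sa := sin_neq0_small aI a0.
rewrite mulrBr mulr1 !sinB.
by field.
Qed.

(** For [a != 0] this is [sin A sin (p - A) - sin B sin (p - B) = sin (A - B) sin (p - A - B)]
    divided by [sin a], with [A = a t] and [B = a s]. *)
Lemma arc_coef_sin_sub a p s t : - pi < a < pi ->
  arc_coef a t * sin (p - a * t) - arc_coef a s * sin (p - a * s) =
  arc_coef a (t - s) * sin (p - (a * s + a * t)).
Proof.
move=> aI; rewrite /arc_coef; case: eqVneq => [->|a0].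
  by rewrite !mul0r addr0 subr0; ring.
have sa := sin_neq0_small aI a0.
rewrite mulrBr (sinB (a * t) (a * s)) !sinB sinD cosD.
have := cos2Dsin2 (a * t); have := cos2Dsin2 (a * s).
move: (cos (a * t)) (sin (a * t)) (cos (a * s)) (sin (a * s)) => ct st cs ss hs ht.
set A := st * (sin p * ct - cos p * st); set B := ss * (sin p * cs - cos p * ss).
(* Multiplying by [cos^2 + sin^2] of the other angle makes both sides homogeneous, so that the
   identity becomes polynomial. *)
have e1 : A * (cs ^+ 2 + ss ^+ 2) = A by rewrite hs mulr1.
have e2 : B * (ct ^+ 2 + st ^+ 2) = B by rewrite ht mulr1.
transitivity ((A - B) / sin a); first by rewrite /A /B; field.
rewrite -e1 -e2 /A /B; field.
by [].
Qed.

(* One edge seen from the origin: it goes from polar coordinates (r, al) to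
   (r', al + 2c), and p and q are the angles between its tangents and the radii
   (directed towards the origin) at its two ends.  ed_rr' is the law of sines. *)
Record edge_data (r r' c d p q a : R) : Prop := EdgeData {
  ed_r : 0 < r;
  ed_r' : 0 < r';
  ed_c : 0 < c;
  ed_cd : c + `|d| < pi / 2;
  ed_rr' : r * cos (c - d) = r' * cos (c + d);
  ed_p : 0 <= p <= pi;
  ed_q : 0 <= q <= pi;
  ed_pa : a = p - pi / 2 + c - d;
  ed_qa : a = q - pi / 2 + c + d }.

Section Edge.
Variables (r r' al c d p q a : R).
Hypothesis E : edge_data r r' c d p q a.

Let P := pscale r (dir al).
Let Q := pscale r' (dir (al + 2 * c)).
(** The length of the chord, by the law of sines in the triangle spanned by the origin, [P] and [Q],
    whose angle at [Q] is [pi / 2 - c - d]. *)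
Let l := r * sin (2 * c) / cos (c + d).
Let z := arc_point P Q a.

Lemma edge_bounds : [/\ - (pi / 2) < c + d, c + d < pi / 2, - (pi / 2) < c - d & c - d < pi / 2].
Proof.
have := ed_c E; have := ed_cd E; have := ler_norm d; have := ler_norm (- d).
by rewrite normrN => *; split; lra.
Qed.

Lemma cos_edge_gt0 : 0 < cos (c + d) /\ 0 < cos (c - d).
Proof. by have [*] := edge_bounds; split; apply: cos_gt0_pihalf; apply/andP. Qed.

Lemma edge_2c : 0 < 2 * c < pi.
Proof. by have := ed_c E; have := ed_cd E; have := normr_ge0 d; lra. Qed.

Lemma edge_length_gt0 : 0 < l.
Proof.
rewrite /l divr_gt0 ?(cos_edge_gt0.1) // mulr_gt0 ?(ed_r E) //.
by apply: sin_gt0_pi; exact: edge_2c.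
Qed.

Lemma edge_angle : - pi < a < pi.
Proof.
have [b1 b2 b3 b4] := edge_bounds; have /andP[p0 p1] := ed_p E.
have /andP[q0 q1] := ed_q E.
by have := ed_pa E; have := ed_qa E; have := ed_c E; lra.
Qed.

(** Together with [edge_radial] this resolves the chord along the radius at [P] and its normal;
    [ed_rr'] eliminates one of the radii. *)
Lemma edge_transverse : r' * sin (2 * c) = l * cos (c - d).
Proof.
have [c1 _] := cos_edge_gt0; have c1n : cos (c + d) != 0 by rewrite gt_eqF.
rewrite /l; have := ed_rr' E => h.
have -> : r * sin (2 * c) / cos (c + d) * cos (c - d) =
   (r * cos (c - d)) * sin (2 * c) / cos (c + d) by field.
by rewrite h; field.
Qed.

Lemma edge_radial : r' * cos (2 * c) = r - l * sin (c - d).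
Proof.
have [c1 _] := cos_edge_gt0; have c1n : cos (c + d) != 0 by rewrite gt_eqF.
apply: (mulIf c1n); rewrite mulrBl /l.
have -> : r * sin (2 * c) / cos (c + d) * sin (c - d) * cos (c + d) =
  r * (sin (2 * c) * sin (c - d)) by field.
have -> : r' * cos (2 * c) * cos (c + d) = (r' * cos (c + d)) * cos (2 * c) by ring.
rewrite -(ed_rr' E).
have -> : cos (c + d) = cos (2 * c - (c - d)) by congr cos; ring.
by rewrite (cosB (2 * c)); ring.
Qed.

Lemma edge_chord : psub Q P = pscale l (dir (al + pi / 2 + c - d)).
Proof.
have [c1 _] := cos_edge_gt0; have c1n : cos (c + d) != 0 by rewrite gt_eqF.
have hs : r' * sin (2 * c) = l * cos (c - d) := edge_transverse.
have hc := edge_radial.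
have -> : al + pi / 2 + c - d = (al + (c - d)) + pi / 2 by ring.
rewrite /psub /pscale /Q /P /dir /= cosDpihalf sinDpihalf !(cosD al) !(sinD al).
congr (_, _).
- transitivity (cos al * (r' * cos (2 * c)) - sin al * (r' * sin (2 * c)) - r * cos al).
    by ring.
  by rewrite hs hc; ring.
- transitivity (sin al * (r' * cos (2 * c)) + cos al * (r' * sin (2 * c)) - r * sin al).
    by ring.
  by rewrite hs hc; ring.
Qed.

(** Polar coordinates centred at [P]: the chord to the moving point turns linearly, starting from
    the tangent direction at [P]. *)
Lemma edge_pointE t :
  z t = padd P (pscale (l * arc_coef a t) (dir (al + pi - p + a * t))).
Proof.
rewrite /z /arc_point edge_chord rot_pscale_dir pscaleA; congr padd.
rewrite [l * _]mulrC; congr (pscale _ (dir _)).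
by have := ed_pa E => h; lra.
Qed.

Lemma edge_point0 : z 0 = P.
Proof.
by rewrite edge_pointE arc_coef0 mulr0 /padd /pscale /= !mul0r !addr0.
Qed.

Lemma edge_point1 : z 1 = Q.
Proof.
rewrite /z /arc_point (arc_coef1 edge_angle) subrr mulr0 /rot cos0 sin0.
by rewrite /Q /P /padd /pscale /psub /=; congr (_, _); ring.
Qed.

Lemma edge_point_revE t : z t = padd Q (pscale (l * arc_coef a (1 - t))
   (dir (al + 2 * c + pi + q - a * (1 - t)))).
Proof.
have /= h := edge_chord.
have -> : z t = padd Q (pscale (-1) (padd (psub Q P) (pscale (- arc_coef a t)
    (rot (a * (t - 1)) (psub Q P))))).
  by rewrite /z /arc_point /rot /padd /pscale /psub /=; congr (_, _); ring.
congr padd; rewrite h rot_pscale_dir !pscaleA.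
set g := al + pi / 2 + c - d.
have -> : al + 2 * c + pi + q - a * (1 - t) = (g + a * t) + pi.
  by rewrite /g; have := ed_qa E => hq; lra.
have -> : a * (t - 1) + g = (g + a * t) - a by ring.
have aI := edge_angle.
(* The interpolation at an angle and at its shift by [pi / 2] yields the second and the first
   coordinate. *)
have i1 := sin_arc_interp t (g + a * t) aI.
have i2 := sin_arc_interp t (g + a * t + pi / 2) aI.
have e1 : g + a * t - a * t = g by ring.
have e2 : g + a * t + pi / 2 - a * t = g + pi / 2 by ring.
have e3 : g + a * t + pi / 2 - a = (g + a * t - a) + pi / 2 by ring.
rewrite e1 in i1; rewrite e2 e3 !sinDpihalf in i2.
rewrite dirDpi /pscale /padd /dir /= i1 i2.
by congr (_, _); ring.
Qed.

(* With C = arc_coef a, the bracket is the expansion of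
   r sin (p - a (s + t)) + l sin a C(s) C(t) in the basis C(1 - .), C(.) in each
   variable; all its coefficients are nonnegative. *)
Lemma edge_cross s t : cross (z s) (z t) = l * arc_coef a (t - s) *
  (r * sin p * arc_coef a (1 - s) * arc_coef a (1 - t) +
   r * cos (c - d) * (arc_coef a (1 - s) * arc_coef a t +
                      arc_coef a s * arc_coef a (1 - t)) +
   r' * sin q * arc_coef a s * arc_coef a t).
Proof.
have aI := edge_angle.
rewrite !edge_pointE !crossDl !crossDr crossuu add0r !cross_dir.
have -> : al + pi - p + a * t - al = pi - (p - a * t) by ring.
have -> : al - (al + pi - p + a * s) = (p - a * s) - pi by ring.
have -> : al + pi - p + a * t - (al + pi - p + a * s) = a * (t - s) by ring.
have sp (x : R) : sin (pi - x) = sin x.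
  by rewrite sinB sinpi cospi mul0r sub0r mulN1r opprK.
have sp' (x : R) : sin (x - pi) = - sin x by rewrite -opprB sinN sp.
rewrite sp sp' -(sinM_arc_coef (t - s) aI).
transitivity (l * (r * (arc_coef a t * sin (p - a * t) - arc_coef a s * sin (p - a * s))
  + l * arc_coef a s * arc_coef a t * (sin a * arc_coef a (t - s)))); first by ring.
rewrite (arc_coef_sin_sub p s t aI).
have -> : p - (a * s + a * t) = (p - a * s) - a * t by ring.
rewrite (sin_arc_interp t _ aI).
have -> : p - a * s - a = (p - a) - a * s by ring.
rewrite !(sin_arc_interp s _ aI).
have -> : sin (p - a) = cos (c - d).
  have -> : p - a = - (c - d) + pi / 2 by have := ed_pa E; lra.
  by rewrite sinDpihalf cosN.
have -> : r' * sin q = r * sin (p - a - a) + l * sin a.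
  have -> : q = - (c + d - a) + pi / 2 by have := ed_qa E; lra.
  have -> : p - a - a = - (c - d + a) + pi / 2 by have := ed_pa E; lra.
  rewrite !sinDpihalf !cosN (cosB (c + d)) (cosD (c - d)).
  (* The projections of the two radii on the chord add up to its length. *)
  have hs : r' * sin (c + d) = l - r * sin (c - d).
    have -> : c + d = 2 * c - (c - d) by ring.
    rewrite (sinB (2 * c)) mulrBr.
    transitivity ((r' * sin (2 * c)) * cos (c - d) - (r' * cos (2 * c)) * sin (c - d)).
      by ring.
    have /= -> := edge_transverse; have /= -> := edge_radial.
    transitivity (l * (cos (c - d) ^+ 2 + sin (c - d) ^+ 2) - r * sin (c - d)).
      by rewrite -/l; ring.
    by rewrite cos2Dsin2 mulr1.
  transitivity (r' * cos (c + d) * cos a + r' * sin (c + d) * sin a); first by ring.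
  by rewrite hs -(ed_rr' E); ring.
by ring.
Qed.

(** The polar angle increases along the edge. In the bracket of [edge_cross] the product of the
    coefficients at [1 - s] and [t] is strictly positive, as [s < 1] and [0 < t]; the other terms
    are nonnegative. *)
Lemma edge_cross_gt0 s t : 0 <= s -> s < t -> t <= 1 -> 0 < cross (z s) (z t).
Proof.
move=> s0 st t1; have aI := edge_angle.
have [_ ccd] := cos_edge_gt0.
have C0 (x : R) : 0 <= x <= 1 -> 0 <= arc_coef a x by exact: arc_coef_ge0.
have Cp (x : R) : 0 < x <= 1 -> 0 < arc_coef a x by exact: arc_coef_gt0.
have r0 := ed_r E; have r'0 := ed_r' E; have r1 := ltW r0; have r'1 := ltW r'0.
rewrite edge_cross; apply: mulr_gt0.
  by rewrite mulr_gt0 ?edge_length_gt0 // Cp //; lra.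
have sp := sin_ge0_pi (ed_p E); have sq := sin_ge0_pi (ed_q E).
have h1 : 0 <= r * sin p * arc_coef a (1 - s) * arc_coef a (1 - t).
  by rewrite !mulr_ge0 // ?C0 //; lra.
have h2 : 0 <= r' * sin q * arc_coef a s * arc_coef a t.
  by rewrite !mulr_ge0 // ?C0 //; lra.
have h3 : 0 < r * cos (c - d) * (arc_coef a (1 - s) * arc_coef a t +
                      arc_coef a s * arc_coef a (1 - t)).
  apply: mulr_gt0; first exact: mulr_gt0.
  apply: ltr_wpDr; first by rewrite mulr_ge0 // C0 //; lra.
  by rewrite mulr_gt0 // Cp //; lra.
lra.
Qed.

Lemma edge_tan_out : rot (- a) (psub Q P) = pscale l (dir (al + pi - p)).
Proof.
rewrite edge_chord rot_pscale_dir; congr (pscale _ (dir _)).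
by have := ed_pa E; lra.
Qed.

Lemma edge_tan_in :
  pscale (-1) (rot a (psub Q P)) = pscale l (dir (al + 2 * c + pi + q)).
Proof.
rewrite edge_chord rot_pscale_dir pscaleA [_ * l]mulrC -pscaleA -dirDpi.
congr (pscale _ (dir _)).
by have := ed_qa E; lra.
Qed.

End Edge.

Lemma continuous_arc_coef a : continuous (arc_coef a).
Proof.
rewrite /arc_coef; case: (a == 0) => t; first exact: cvg_id.
apply: (@continuousM R _ (fun t => sin (a * t)) (fun=> (sin a)^-1)).
  apply: (@continuous_comp _ _ _ (fun t => a * t) sin); last exact: continuous_sin.
  by apply: (@continuousM R _ (fun=> a) id); [exact: cst_continuous|exact: cvg_id].
exact: cst_continuous.
Qed.

Lemma continuous_arc_point u w a : continuous (arc_point u w a).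
Proof.
have sc (f g : R -> R) : continuous f -> continuous g -> continuous (fun t => f (g t)).
  by move=> cf cg t; apply: (@continuous_comp _ _ _ g f); [exact: cg|exact: cf].
have M (f g : R -> R) : continuous f -> continuous g -> continuous (fun t => f t * g t).
  by move=> cf cg t; apply: (@continuousM R _ f g); [exact: cf|exact: cg].
have A (f g : R -> R) : continuous f -> continuous g -> continuous (fun t => f t + g t).
  by move=> cf cg t; apply: (@continuousD _ R R f g); [exact: cf|exact: cg].
have B (f g : R -> R) : continuous f -> continuous g -> continuous (fun t => f t - g t).
  by move=> cf cg t; apply: (@continuousB _ R R f g); [exact: cf|exact: cg].
have K (k : R) : continuous (fun _ : R => k) by exact: cst_continuous.
have I : continuous (fun t : R => a * (t - 1)).
  by apply: (M (fun=> a) (fun t => t - 1)) => //; apply: B => // t; exact: cvg_id.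
have cc : continuous (fun t : R => cos (a * (t - 1))) by apply: sc => //; exact: continuous_cos.
have cs : continuous (fun t : R => sin (a * (t - 1))) by apply: sc => //; exact: continuous_sin.
apply: continuous_pair => /=.
- exact: (A _ _ (K _) (M _ _ (@continuous_arc_coef a) (B _ _ (M _ _ cc (K _)) (M _ _ cs (K _))))).
- exact: (A _ _ (K _) (M _ _ (@continuous_arc_coef a) (A _ _ (M _ _ cs (K _)) (M _ _ cc (K _))))).
Qed.

End Directions.

(** * Polar coordinates of points *)

Section Polar.
Variable R : realType.
Implicit Types (x y a t s r k : R) (u w z : R * R).

Lemma parallel_dir x z : cross (dir x) z = 0 ->
  z = pscale (cos x * z.1 + sin x * z.2) (dir x).
Proof.
case: z => z1 z2; rewrite /cross /pscale /dir /= => h.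
have e := cos2Dsin2 x.
congr (_, _).
- transitivity (z1 * (cos x ^+ 2 + sin x ^+ 2) + sin x * (cos x * z2 - sin x * z1)).
    by rewrite e h; ring.
  by ring.
- transitivity (z2 * (cos x ^+ 2 + sin x ^+ 2) - cos x * (cos x * z2 - sin x * z1)).
    by rewrite e h; ring.
  by ring.
Qed.

Lemma cross_neq0 u w : cross u w != 0 -> u <> (0, 0).
Proof. by move=> /eqP h uE; apply: h; rewrite uE /cross /=; ring. Qed.

Lemma pscale_dir_neq0 k x : k != 0 -> pscale k (dir x) <> (0, 0).
Proof.
move=> k0 [/eqP]; rewrite mulf_eq0 (negbTE k0) /= => /eqP c0 /eqP.
by rewrite mulf_eq0 (negbTE k0) /= => /eqP s0; apply: (dir_neq0 (x := x)); rewrite /dir c0 s0.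
Qed.

Lemma continuous_cross_dir z : continuous (fun x => cross (dir x) z).
Proof.
move=> x; apply: (@continuousB _ R R (fun x => cos x * z.2) (fun x => sin x * z.1)).
- by apply: (@continuousM R _ cos (fun=> z.2)); [exact: continuous_cos|exact: cst_continuous].
- by apply: (@continuousM R _ sin (fun=> z.1)); [exact: continuous_sin|exact: cst_continuous].
Qed.

Lemma IVT_decr (f : R -> R) x y : x <= y -> continuous f -> 0 <= f x -> f y <= 0 ->
  exists2 t, x <= t <= y & f t = 0.
Proof.
move=> xy cf fx fy.
have [||t] := @IVT R f x y 0 xy; last 1 first.
- by rewrite in_itv; exists t.
- exact: continuous_subspaceT.
- by rewrite ge_min fy orbT /= le_max fx.
Qed.

(** The cross product of a rotating direction with [z] changes sign between [x] and [y], so some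
    direction is parallel to [z]. A negative factor would force both sines to vanish and hence
    [x = y]. *)
Lemma cone_dir x y z : 0 < y - x < pi -> z <> (0, 0) ->
  0 <= cross (dir x) z -> 0 <= cross z (dir y) ->
  exists k ps, [/\ 0 < k, x <= ps <= y & z = pscale k (dir ps)].
Proof.
move=> /andP[xy0 xypi] z0 hx hy.
have [||||ps psI hps] := @IVT_decr (fun ps => cross (dir ps) z) x y.
- by lra.
- exact: continuous_cross_dir.
- exact: hx.
- by rewrite crossC oppr_le0.
have zE := parallel_dir hps.
set k := _ + _ in zE.
exists k, ps; split => //.
have kn0 : k != 0.
  by apply/eqP => k0; apply: z0; rewrite zE k0 /pscale !mul0r.
rewrite lt_neqAle eq_sym kn0 /= leNgt; apply/negP => kn.
rewrite zE in hx hy; rewrite -(pscale1 (dir x)) cross_dir mul1r in hx.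
rewrite -(pscale1 (dir y)) cross_dir mulr1 in hy.
have sx : 0 <= sin (ps - x) by apply: sin_ge0_pi; lra.
have sy : 0 <= sin (y - ps) by apply: sin_ge0_pi; lra.
have sx0 : sin (ps - x) = 0 by nra.
have sy0 : sin (y - ps) = 0 by nra.
have ex : ps - x = 0 by apply: sin_eq0_small => //; have := pi_gt0 R; lra.
have ey : y - ps = 0 by apply: sin_eq0_small => //; have := pi_gt0 R; lra.
by lra.
Qed.

(** Quadrant by quadrant, since [cone_dir] needs an opening below [pi]. *)
Lemma polar z : z <> (0, 0) ->
  exists k ps, [/\ 0 < k, 0 <= ps <= 2 * pi & z = pscale k (dir ps)].
Proof.
move=> z0; have pi0 := pi_gt0 R.
have d0 : dir (0 : R) = (1, 0) by rewrite /dir cos0 sin0.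
have d1 : dir (pi / 2 : R) = (0, 1) by rewrite /dir cos_pihalf sin_pihalf.
have d2 : dir (pi : R) = (-1, 0) by rewrite /dir cospi sinpi.
have d3 : dir (pi / 2 + pi : R) = (0, -1) by rewrite dirDpi d1 /pscale mulr0 mulr1.
have d4 : dir (2 * pi : R) = (1, 0) by rewrite -[2 * pi]add0r dirD2pi.
have quad x y : 0 <= x -> y <= 2 * pi -> 0 < y - x < pi ->
    0 <= cross (dir x) z -> 0 <= cross z (dir y) ->
    exists k ps, [/\ 0 < k, 0 <= ps <= 2 * pi & z = pscale k (dir ps)].
  move=> x0 y0 xy hx hy; have [k [ps [k0 psI zE]]] := cone_dir xy z0 hx hy.
  by exists k, ps; split=> //; lra.
have [z1|z1] := leP 0 z.1; have [z2|z2] := leP 0 z.2.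
- by apply: (quad 0 (pi / 2)); rewrite ?d0 ?d1 /cross /=; lra.
- by apply: (quad (pi / 2 + pi) (2 * pi)); rewrite ?d3 ?d4 /cross /=; lra.
- by apply: (quad (pi / 2) pi); rewrite ?d1 ?d2 /cross /=; lra.
- by apply: (quad pi (pi / 2 + pi)); rewrite ?d2 ?d3 /cross /=; lra.
Qed.

(** Compares two equal directions. Both solutions matter: [2 * pi] arises where the last edge meets
    the first one. *)
Lemma sin_eq0_2pi x : 0 <= x <= 2 * pi -> sin x = 0 -> 0 < cos x ->
  x = 0 \/ x = 2 * pi.
Proof.
move=> /andP[x0 x2] sx cx; have pi0 := pi_gt0 R.
have xn : x != pi by apply/eqP => xE; move: cx; rewrite xE cospi; lra.
have [xpi|xpi] := ltP x pi.
  by left; apply: sin_eq0_small => //; lra.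
right; have xpi' : pi < x by rewrite lt_neqAle eq_sym xn.
have : x - 2 * pi = 0; last by lra.
apply: sin_eq0_small; first by lra.
have -> : x - 2 * pi = - (pi - (x - pi)) by ring.
by rewrite sinN sinB sinpi cospi sinB cospi sinpi sx; ring.
Qed.

End Polar.

(** * Star-shaped curves *)

Section Star.
Variables (R : realType) (n : nat).
(** Angles and radii are indexed by [nat] so that the last sector can end at [Psi n = 2 * pi]
    although the vertex there is the one at angle 0. *)
Variables (v : 'I_n -> R * R) (a : 'I_n -> R) (Psi : nat -> R) (rho : nat -> R).
Hypothesis n2 : (1 < n)%N.
Hypothesis Psi0 : Psi 0%N = 0.
Hypothesis Psin : Psi n = 2 * pi.
Hypothesis PsiS : forall k, (k < n)%N -> 0 < Psi k.+1 - Psi k < pi.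
Hypothesis rho0 : forall k, 0 < rho k.
Hypothesis vE : forall i : 'I_n, v i = pscale (rho i) (dir (Psi i)).
Hypothesis vnE : forall i : 'I_n, v (nxt i) = pscale (rho i.+1) (dir (Psi i.+1)).
Let z (i : 'I_n) := arc_point (v i) (v (nxt i)) (a i).
Hypothesis z0 : forall i, z i 0 = v i.
Hypothesis z1 : forall i, z i 1 = v (nxt i).
Hypothesis z_cross : forall (i : 'I_n) (s t : R), 0 <= s -> s < t -> t <= 1 -> 0 < cross (z i s) (z i t).

Lemma edgeP i w : edge v a i w <-> exists2 t, 0 <= t <= 1 & w = z i t.
Proof.
split=> [[t]|[t t01 ->]]; first by rewrite /= in_itv /= => t01 <-; exists t.
by exists t => //=; rewrite in_itv.
Qed.

Lemma Psi_lt k m : (k < m)%N -> (m <= n)%N -> Psi k < Psi m.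
Proof.
elim: m => // m IH; rewrite ltnS leq_eqVlt => /orP[/eqP ->|km] mn.
  by have := PsiS mn; lra.
by have := PsiS mn; have := IH km (ltnW mn); lra.
Qed.

Lemma Psi_le k m : (k <= m)%N -> (m <= n)%N -> Psi k <= Psi m.
Proof.
rewrite leq_eqVlt => /orP[/eqP -> //|km mn].
by apply: ltW; exact: Psi_lt.
Qed.

Lemma Psi_inj k m : (k <= m)%N -> (m <= n)%N -> Psi k = Psi m -> k = m.
Proof.
rewrite leq_eqVlt => /orP[/eqP -> //|km mn] h.
by have := Psi_lt km mn; rewrite h ltxx.
Qed.

Lemma star_neq0 i t : 0 <= t <= 1 -> z i t <> (0, 0).
Proof.
move=> /andP[t0 t1]; have [t1'|t1'] := ltP t 1.
  by apply: (@cross_neq0 _ _ (z i 1)); rewrite gt_eqF // z_cross.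
have tp : 0 < t by lra.
by apply: (@cross_neq0 _ _ (z i 0)); rewrite crossC oppr_eq0 gt_eqF // z_cross.
Qed.

(** The edge stays in its sector because its cross products with both end radii have a sign. The
    last two clauses hold as these are strict away from the ends; they reduce meetings of different
    edges to shared vertices. *)
Lemma star_dir (i : 'I_n) t : 0 <= t <= 1 -> exists k ps,
  [/\ 0 < k, Psi i <= ps <= Psi i.+1, z i t = pscale k (dir ps),
      ps = Psi i -> t = 0 & ps = Psi i.+1 -> t = 1].
Proof.
move=> tI; have zn0 := star_neq0 (i := i) tI; move: tI => /andP[t0 t1].
have r0 := rho0 i; have r1 := rho0 i.+1.
have c0 : 0 <= cross (dir (Psi i)) (z i t).
  rewrite -(pmulr_rge0 _ r0) -crossZl -vE -z0.
  have [->|tn0] := eqVneq t 0; first by rewrite crossuu.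
  by apply/ltW/z_cross => //; lra.
have c1 : 0 <= cross (z i t) (dir (Psi i.+1)).
  rewrite -(pmulr_rge0 _ r1) -crossZr -vnE -z1.
  have [->|tn1] := eqVneq t 1; first by rewrite crossuu.
  by apply/ltW/z_cross => //; lra.
have [k [ps [k0 psI zE]]] := cone_dir (PsiS (ltn_ord i)) zn0 c0 c1.
exists k, ps; split=> // psE; apply/eqP; apply/negPn/negP => tn.
- have : 0 < cross (z i 0) (z i t) by apply: z_cross => //; lra.
  by rewrite z0 vE zE psE cross_dir subrr sin0 mulr0 ltxx.
- have : 0 < cross (z i t) (z i 1) by apply: z_cross => //; lra.
  by rewrite z1 vnE zE psE cross_dir subrr sin0 mulr0 ltxx.
Qed.

Lemma star_hit (i : 'I_n) ps : Psi i <= ps <= Psi i.+1 ->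
  exists k t, [/\ 0 < k, 0 <= t <= 1 & z i t = pscale k (dir ps)].
Proof.
move=> psI.
have [||||t tI ht] := @IVT_decr R (fun t => cross (z i t) (dir ps)) 0 1.
- exact: ler01.
- move=> t; rewrite /cross.
  have ca := @continuous_arc_point R (v i) (v (nxt i)) (a i) t.
  apply: (@continuousB _ R R (fun t => (z i t).1 * sin ps) (fun t => (z i t).2 * cos ps)).
  + apply: (@continuousM R _ (fun t => (z i t).1) (fun=> sin ps)); last exact: cst_continuous.
    by apply: (@continuous_comp _ _ _ (z i) fst); [exact: ca|exact: cvg_fst].
  + apply: (@continuousM R _ (fun t => (z i t).2) (fun=> cos ps)); last exact: cst_continuous.
    by apply: (@continuous_comp _ _ _ (z i) snd); [exact: ca|exact: cvg_snd].
- rewrite z0 vE -(pscale1 (dir ps)) cross_dir mulr1 mulr_ge0 ?(ltW (rho0 _)) //.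
  by apply: sin_ge0_pi; have := PsiS (ltn_ord i); lra.
- rewrite z1 vnE -(pscale1 (dir ps)) cross_dir mulr1 -oppr_ge0 -mulrN -sinN opprB.
  rewrite mulr_ge0 ?(ltW (rho0 _)) //.
  by apply: sin_ge0_pi; have := PsiS (ltn_ord i); lra.
have {}ht : cross (dir ps) (z i t) = 0 by rewrite crossC ht oppr0.
(* The zero only gives a point on the line of direction [ps]; confinement to a sector narrower than
   [pi] excludes the opposite ray. *)
have [k [q [k0 qI zE _ _]]] := star_dir i tI.
exists k, t; split=> //; rewrite zE; congr (pscale _ (dir _)).
move: ht; rewrite zE -(pscale1 (dir ps)) cross_dir mul1r => /eqP.
rewrite mulf_eq0 gt_eqF //= => /eqP hs.
have : q - ps = 0; last by lra.
by apply: sin_eq0_small => //; have := PsiS (ltn_ord i); lra.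
Qed.

Lemma Psi_locate m ps : (m <= n)%N -> 0 <= ps <= Psi m -> (0 < m)%N ->
  exists2 k, (k < m)%N & Psi k <= ps <= Psi k.+1.
Proof.
elim: m => // m IH mn psI _.
have [h|h] := leP (Psi m) ps.
  by exists m => //; lra.
case: m IH mn psI h => [|m] IH mn psI h; first by rewrite Psi0 in h; lra.
have [||k km kI] := IH (ltnW mn) => //; first by lra.
by exists k => //; exact: ltnW.
Qed.

Lemma star_cover w : w <> (0, 0) ->
  exists i t l, [/\ 0 <= t <= 1, 0 < l & w = pscale l (z i t)].
Proof.
move=> /polar[k [ps [k0 psI ->]]].
have [||j jn jI] := @Psi_locate n ps (leqnn n); [by rewrite Psin|exact: ltnW|].
have [l [t [l0 tI zE]]] := @star_hit (Ordinal jn) ps jI.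
exists (Ordinal jn), t, (k / l); split=> //; first exact: divr_gt0.
by rewrite zE pscaleA divfK // gt_eqF.
Qed.

Lemma nxt_succ (i j : 'I_n) : i.+1 = j -> j = nxt i.
Proof. by move=> h; apply: val_inj; rewrite /= modn_small h. Qed.

Lemma nxt_last (i j : 'I_n) : j.+1 = n -> i = 0%N :> nat -> i = nxt j.
Proof. by move=> h h0; apply: val_inj; rewrite /= h0 h modnn. Qed.

(** On one edge the positive cross products separate parameters. For different edges the sectors
    overlap at most in a boundary direction, hence in a vertex. The factor [l] serves both
    simplicity ([l = 1]) and the comparison of points along a ray. *)
Lemma ray_unique (i j : 'I_n) s t l : 0 <= s <= 1 -> 0 <= t <= 1 -> 0 < l ->
  z i s = pscale l (z j t) ->
  [\/ i = j /\ s = t, [/\ j = nxt i, s = 1 & t = 0] | [/\ i = nxt j, s = 0 & t = 1]].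
Proof.
wlog ij : i j s t l / (i <= j)%N => [W sI tI l0 h|].
  have [ij|/ltnW ji] := leqP i j; first exact: (W i j s t l).
  have h' : z j t = pscale l^-1 (z i s).
    by rewrite h pscaleA mulVf ?pscale1 // gt_eqF.
  have li : 0 < l^-1 by rewrite invr_gt0.
  by have [[-> ->]|[]|[]] := W _ _ _ _ _ ji tI sI li h';
    [constructor 1|constructor 3|constructor 2].
move=> sI tI l0 h.
move: ij; rewrite leq_eqVlt => /orP[/eqP/val_inj ij|ij].
  constructor 1; split=> //; subst j; apply/eqP; apply/negPn/negP => st.
  have cz : cross (z i s) (z i t) = 0 by rewrite h crossZl crossuu mulr0.
  have : 0 < cross (z i s) (z i t) \/ 0 < cross (z i t) (z i s).
    have [lst|] := ltP s t; first by left; apply: z_cross => //; lra.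
    by move=> lts; right; apply: z_cross => //; lra.
  by rewrite (crossC (z i s)) cz oppr0 ltxx; case.
have [k [ps [k0 /andP[psl psr] zE e0 e1]]] := star_dir i sI.
have [m [qs [m0 /andP[qsl qsr] wE f0 f1]]] := star_dir j tI.
have Pij : Psi i.+1 <= Psi j by apply: Psi_le => //; exact: ltnW.
have Pi0 : 0 <= Psi i by rewrite -Psi0; apply: Psi_le => //; exact: ltnW.
have Pjn : Psi j.+1 <= 2 * pi by rewrite -Psin; apply: Psi_le.
rewrite zE wE pscaleA in h.
have lm0 : 0 < l * m by exact: mulr_gt0.
have hc := congr1 (fun w => cross (dir ps) w) h.
have hs : sin (qs - ps) = 0.
  move: hc => /=; rewrite crossZr crossuu mulr0 -{1}(pscale1 (dir ps)) cross_dir mul1r.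
  by move/esym/eqP; rewrite mulf_eq0 gt_eqF //= => /eqP.
have hd : 0 < cos (qs - ps).
  move: h; rewrite /pscale /dir /= => -[hx hy].
  have : (l * m) * cos (qs - ps) = k * (cos ps ^+ 2 + sin ps ^+ 2).
    rewrite cosB mulrDr !mulrA -hx -hy; ring.
  by rewrite cos2Dsin2 mulr1 => e; rewrite -(pmulr_rgt0 _ lm0) e.
(* Difference 0 means that the sectors are adjacent; difference [2 * pi] means that they are the
   first and the last one. *)
have [|qp|qp] := sin_eq0_2pi _ hs hd; first by lra.
- have psE : ps = Psi i.+1 by lra.
  have qsE : qs = Psi j by lra.
  constructor 2; split; [|exact: e1|exact: f0].
  apply: nxt_succ; apply: Psi_inj => //; first exact: ltnW.
  by lra.
- have psE : ps = Psi i by lra.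
  have qsE : qs = Psi j.+1 by lra.
  constructor 3; split; [|exact: e0|exact: f1].
  apply: nxt_last.
    by apply: Psi_inj => //; rewrite Psin; lra.
  by apply/esym/Psi_inj => //; [exact: ltnW|rewrite Psi0; lra].
Qed.

Lemma curveP w : curve v a w <-> exists i t, 0 <= t <= 1 /\ w = z i t.
Proof.
split=> [[i _ /edgeP[t tI ->]]|[i [t [tI ->]]]]; first by exists i, t.
by exists i => //; apply/edgeP; exists t.
Qed.

(** The factor [l] is the level of a point: its distance from the origin relative to that of the
    curve in the same direction. Level 0 accounts for the origin. *)
Definition star_inside : set (R * R) :=
  [set w | exists i t l, [/\ 0 <= t <= 1, 0 <= l < 1 & w = pscale l (z i t)]].
Definition star_outside : set (R * R) :=
  [set w | exists i t l, [/\ 0 <= t <= 1, 1 < l & w = pscale l (z i t)]].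

(** The level is well defined because a ray hits the curve once; this makes inside, curve and
    outside disjoint. *)
Lemma star_ray_level i j s t l m : 0 <= s <= 1 -> 0 <= t <= 1 -> 0 <= l -> 0 < m ->
  pscale l (z i s) = pscale m (z j t) -> l = m.
Proof.
move=> sI tI l0 m0 h.
have ln0 : l != 0.
  apply/eqP => l0'; apply: (star_neq0 (i := j) tI).
  have -> : z j t = pscale m^-1 (pscale m (z j t)).
    by rewrite pscaleA mulVf ?pscale1 // gt_eqF.
  by rewrite -h l0' /pscale /= !mul0r !mulr0.
have zn := star_neq0 (i := j) tI.
have lp : 0 < l by rewrite lt_neqAle eq_sym ln0.
have h' : z i s = pscale (l^-1 * m) (z j t).
  by rewrite -pscaleA -h pscaleA mulVf // pscale1.
have ml : 0 < l^-1 * m by rewrite mulr_gt0 ?invr_gt0.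
have same : z i s = z j t.
  have [[-> -> //]|[-> -> ->]|[-> -> ->]] := ray_unique sI tI ml h'.
  - by rewrite z0 z1.
  - by rewrite z0 z1.
move: h; rewrite same /pscale => -[h1 h2].
move: zn; rewrite [z j t]surjective_pairing.
have [e1|e1] := eqVneq (z j t).1 0; last first.
  by move=> _; apply: (mulIf e1).
have [e2|e2] := eqVneq (z j t).2 0; last first.
  by move=> _; apply: (mulIf e2).
by rewrite e1 e2.
Qed.

Lemma compact_arc (j : 'I_n) x y : compact [set z j t | t in `[x, y]%classic].
Proof.
apply: continuous_compact; last exact: segment_compact.
by apply: continuous_subspaceT; exact: continuous_arc_point.
Qed.

(** The subinterval allows pieces of an edge that keep away from a vertex. *)
Lemma star_cone_closed (j : 'I_n) x y : closed
  [set w | exists t l, [/\ x <= t <= y, 0 <= l <= 1 & w = pscale l (z j t)]].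
Proof.
have := compact_cone (@compact_arc j x y); congr closed.
apply/seteqP; split=> w /=.
  move=> [l + [_ [t + <-] <-]]; rewrite /= !in_itv /= => lI tI.
  by exists t, l.
move=> [t [l [tI lI ->]]]; exists l; first by rewrite in_itv.
by exists (z j t) => //; exists t => //; rewrite in_itv.
Qed.

Lemma star_shadow_closed (j : 'I_n) x y : 0 <= x -> y <= 1 -> closed
  [set w | exists t l, [/\ x <= t <= y, 1 <= l & w = pscale l (z j t)]].
Proof.
move=> x0 y1.
have cK : closed [set z j t | t in `[x, y]%classic].
  by apply: compact_closed; [exact: norm_hausdorff|exact: compact_arc].
have := shadow_closed cK; congr closed.
apply/seteqP; split=> w /=.
  move=> [m /andP[m0 m1] [t tI zE]]; move: tI; rewrite in_itv /= => tI.
  have mn0 : m != 0.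
    apply/eqP => mE; have t01 : 0 <= t <= 1 by lra.
    apply: (star_neq0 (i := j) t01); rewrite zE mE.
    by rewrite /pscale !mul0r.
  exists t, m^-1; split=> //.
    by rewrite invf_ge1 // lt_neqAle eq_sym mn0.
  by rewrite zE pscaleA mulVf // pscale1.
move=> [t [l [tI l1 ->]]].
have l0 : 0 < l by lra.
exists l^-1; first by rewrite invr_ge0 invf_le1 // (ltW l0).
by exists t; rewrite ?in_itv //= pscaleA mulVf ?pscale1 // gt_eqF.
Qed.

Lemma star_trichotomy w : star_inside w \/ curve v a w \/ star_outside w.
Proof.
have [->|/star_cover[i [t [l [tI l0 ->]]]]] := pselect (w = (0, 0)).
  left; exists (Ordinal (ltnW n2)), 0, 0; split; rewrite ?lexx ?ler01 ?ltr01 //.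
  by rewrite /pscale !mul0r.
have [l1|l1|l1] := ltgtP l 1.
- by left; exists i, t, l; rewrite (ltW l0).
- by right; right; exists i, t, l.
- by right; left; apply/curveP; exists i, t; rewrite l1 pscale1.
Qed.

Lemma star_inside_bounded : bounded_pt star_inside.
Proof.
have bz i : exists M : R, forall t, 0 <= t <= 1 -> `|(z i t).1| <= M /\ `|(z i t).2| <= M.
  have [M [_ HM]] := compact_bounded (@compact_arc i 0 1).
  exists (M + 1) => t tI.
  have /= := HM (M + 1) (ltr_pwDr ltr01 (lexx M)) (z i t).
  have h : [set z i t | t in `[0, 1]%classic] (z i t) by exists t; rewrite //= in_itv.
  by move=> /(_ h); rewrite prod_normE ge_max => /andP.
have [M HM] := choice bz.
exists (\sum_i `|M i|) => _ [i [t [l [tI /andP[l0 l1] ->]]]].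
have [h1 h2] := HM i t tI.
have lM : `|M i| <= \sum_i `|M i|.
  by rewrite (bigD1 i) //= lerDl sumr_ge0.
have b (u : R) : `|u| <= M i -> `|l * u| <= \sum_i `|M i|.
  move=> hu; apply: le_trans lM; rewrite normrM ger0_norm //.
  have := ler_norm (M i); have := normr_ge0 u; nra.
by split; exact: b.
Qed.

Lemma star_regions :
  star_inside `<=` interior_of v a /\ star_outside `<=` exterior_of v a.
Proof.
apply: separated_components.
- exact: star_trichotomy.
- move=> w [i [s [l [sI /andP[l0 l1] ->]]]]; split.
    move=> /curveP[j [t [tI h]]]; rewrite -(pscale1 (z j t)) in h.
    by have := star_ray_level sI tI l0 ltr01 h; lra.
  move=> [j [t [m [tI m1 h]]]]; have m0 : 0 < m by lra.
  by have := star_ray_level sI tI l0 m0 h; lra.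
- move=> w [i [s [l [sI l1 ->]]]] /curveP[j [t [tI h]]].
  rewrite -(pscale1 (z j t)) in h; have l0 : 0 <= l by lra.
  by have := star_ray_level sI tI l0 ltr01 h; lra.
- have := @closed_bigcup _ _ [set: 'I_n] _ finite_finset (fun i _ => @star_cone_closed i 0 1).
  congr closed; apply/seteqP; split=> w /=.
    move=> [i _ [t [l [tI /andP[l0 l1] ->]]]].
    have [l1'|l1'] := ltP l 1; first by left; exists i, t, l; rewrite l0.
    have -> : l = 1 by lra.
    by right; apply/curveP; exists i, t; rewrite pscale1.
  move=> [[i [t [l [tI /andP[l0 l1] ->]]]]|/curveP[i [t [tI ->]]]].
    by exists i => //; exists t, l; split=> //; rewrite l0 ltW.
  by exists i => //; exists t, 1; rewrite pscale1 ler01 lexx.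
- have := @closed_bigcup _ _ [set: 'I_n] _ finite_finset
    (fun i _ => @star_shadow_closed i 0 1 (lexx _) (lexx _)).
  congr closed; apply/seteqP; split=> w /=.
    move=> [i _ [t [l [tI l1 ->]]]].
    have [l1'|l1'] := ltP 1 l; first by left; exists i, t, l.
    have -> : l = 1 by lra.
    by right; apply/curveP; exists i, t; rewrite pscale1.
  move=> [[i [t [l [tI l1 ->]]]]|/curveP[i [t [tI ->]]]].
    by exists i => //; exists t, l; split=> //; rewrite ltW.
  by exists i => //; exists t, 1; rewrite pscale1 lexx.
- exact: star_inside_bounded.
(* Outside points escape radially: moving along the position vector raises the level. *)
- move=> w [i [t [l [tI l1 ->]]]]; exists (pscale l (z i t)); split.
    move=> h; apply: (star_neq0 (i := i) tI); have l0 : 0 < l by lra.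
    have : pscale l^-1 (pscale l (z i t)) = (0, 0) by rewrite h /pscale /= !mulr0.
    by rewrite pscaleA mulVf ?pscale1 // gt_eqF.
  move=> s s0; exists i, t, ((1 + s) * l); split=> //; first by nra.
  by rewrite /padd /pscale /=; congr (_, _); ring.
Qed.

(** * Short rays and distant parts of the curve *)

Lemma eventually_notin (S : set (R * R)) w d : closed S -> ~ S w ->
  exists2 e, 0 < e & forall t, 0 < t < e -> ~ S (padd w (pscale t d)).
Proof.
move=> cS nS.
have : nbhs (padd w (pscale 0 d)) (~` S).
  apply: open_nbhs_nbhs; split; first exact: closed_openC.
  by rewrite /padd /pscale !mul0r !addr0 -surjective_pairing.
move=> /(@continuous_padd_pscale R w d 0).
rewrite nbhs_nearE near_map => /nbhs_ballP[e /= e0 He].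
exists e => // t /andP[t0 te]; apply: He.
by rewrite /ball /= sub0r normrN gtr0_norm.
Qed.

(** The nonnegative multiples of the piece are covered by a closed cone and a closed shadow, neither
    of which contains [w], so a short ray from [w] avoids both. *)
Lemma far_rays (j : 'I_n) w d x y : 0 <= x -> y <= 1 -> w <> (0, 0) ->
  (forall s l, x <= s <= y -> 0 < l -> w <> pscale l (z j s)) ->
  exists2 e, 0 < e & forall t, 0 < t < e -> forall s l, x <= s <= y -> 0 <= l ->
    padd w (pscale t d) <> pscale l (z j s).
Proof.
move=> x0 y1 w0 Hw.
have [|e1 e10 He1] := @eventually_notin _ w d (@star_cone_closed j x y).
  move=> [s [l [sI /andP[l0 _] wE]]]; have [l0'|ln0] := eqVneq l 0.
    by apply: w0; rewrite wE l0' /pscale !mul0r.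
  by apply: (Hw s l) => //; rewrite lt_neqAle eq_sym ln0.
have [|e2 e20 He2] := @eventually_notin _ w d (@star_shadow_closed j x y x0 y1).
  by move=> [s [l [sI l1 wE]]]; apply: (Hw s l) => //; lra.
exists (Num.min e1 e2); first by rewrite lt_min e10 e20.
move=> t; rewrite lt_min => /andP[t0 /andP[te1 te2]] s l sI l0 h.
have [l1|/ltW l1] := leP l 1.
  by apply: (He1 t); rewrite ?t0 //; exists s, l; rewrite l0.
by apply: (He2 t); rewrite ?t0 //; exists s, l.
Qed.

Lemma ray_common_eps (Q : 'I_n -> R -> Prop) :
  (forall j, exists2 e, 0 < e & forall t, 0 < t < e -> Q j t) ->
  exists2 e, 0 < e & forall t, 0 < t < e -> forall j, Q j t.
Proof.
move=> H.
have H' j : exists e, 0 < e /\ forall t, 0 < t < e -> Q j t.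
  by have [e e0 He] := H j; exists e.
have [e He] := choice H'.
exists (\big[Num.min/1]_j e j).
  by apply/bigmin_gtP; split=> // j _; have [] := He j.
move=> t /andP[t0 te] j; have [_] := He j; apply; rewrite t0 /=.
by apply: lt_le_trans te _; exact: bigmin_le_cond.
Qed.

End Star.

(** * Interior angles of star-shaped polygons *)

Section VertexAnalysis.
Variable R : realType.
Implicit Types (al p a rho phi s k l t : R).

Lemma small_multiples (a b : R) : 0 < b ->
  exists2 e, 0 < e <= 1 & forall s, 0 <= s <= e -> - b < a * s < b.
Proof.
move=> b0; have a1 : 0 < `|a| + 1 by rewrite ltr_pwDr.
have e0 : 0 < b / (`|a| + 1) by rewrite divr_gt0.
exists (Num.min 1 (b / (`|a| + 1))).
  by rewrite lt_min ltr01 e0 ge_min lexx.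
move=> s /andP[s0]; rewrite le_min => /andP[_]; rewrite ler_pdivlMr // => sb.
rewrite -ltr_norml normrM (ger0_norm s0); have := normr_ge0 a; nra.
Qed.

Lemma sinpiB (x : R) : sin (pi - x) = sin x.
Proof. by rewrite sinB sinpi cospi mul0r sub0r mulN1r opprK. Qed.

Lemma sinB2pi (x : R) : sin (x - 2 * pi) = sin x.
Proof. by have [_] := dirD2pi (x - 2 * pi); rewrite subrK. Qed.

Lemma sin_wedge_ge0 p a s : 0 <= p <= pi -> 0 <= p - a <= pi -> 0 <= s <= 1 ->
  0 <= sin (p - a * s).
Proof. by move=> p1 p2 s1; apply: sin_ge0_pi; nra. Qed.

(* Near a vertex only the two incident arcs matter.  An equation v + t w = l (v + k u),
   with u the direction of a short chord, is tested against u itself: this kills k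
   and leaves t (w x u) = (l - 1) (v x u), whose two sides have opposite signs. *)
Lemma arc_avoid_in al p a rho phi : 0 < rho -> 0 <= p <= pi -> 0 <= p - a <= pi ->
  0 < phi < pi ->
  exists2 e, 0 < e <= 1 & forall s k l t, 0 <= s <= e -> 0 <= k -> 1 <= l -> 0 < t ->
  padd (pscale rho (dir al)) (pscale t (dir (al + pi - p + phi))) <>
  pscale l (padd (pscale rho (dir al)) (pscale k (dir (al + pi - p + a * s)))).
Proof.
move=> r0 pI paI /andP[f0 f1].
have [|e eI He] := @small_multiples a (Num.min phi (pi - phi)).
  by rewrite lt_min f0 /=; lra.
exists e => // s k l t sI k0 l1 t0.
have /andP[b1 b2] := He s sI.
have b3 : Num.min phi (pi - phi) <= phi by rewrite ge_min lexx.
have b4 : Num.min phi (pi - phi) <= pi - phi by rewrite ge_min lexx orbT.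
have s1 : 0 <= s <= 1 by lra.
have sw := sin_wedge_ge0 pI paI s1.
set u := dir (al + pi - p + a * s).
move=> /(congr1 (fun w => cross w (pscale 1 u))).
rewrite crossZl !crossDl !cross_dir subrr sin0 mulr0 addr0 !mulr1.
have -> : al + pi - p + a * s - al = pi - (p - a * s) by ring.
have -> : al + pi - p + a * s - (al + pi - p + phi) = - (phi - a * s) by ring.
rewrite sinpiB sinN.
have sp : 0 < sin (phi - a * s) by apply: sin_gt0_pi; lra.
have h1 : 0 < t * sin (phi - a * s) by exact: mulr_gt0.
have h2 : 0 <= (l - 1) * (rho * sin (p - a * s)).
  by rewrite !mulr_ge0 // ?subr_ge0 // ltW.
by lra.
Qed.

(** For [phi > pi] the test against [u] works again, with the sine of opposite sign. For smaller
    [phi] another test vector is needed. *)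
Lemma arc_avoid_out al p a rho phi : 0 < rho -> 0 <= p <= pi -> 0 <= p - a <= pi ->
  p < phi < 2 * pi ->
  exists2 e, 0 < e <= 1 & forall s k l t, 0 <= s <= e -> 0 <= k -> 0 <= l <= 1 -> 0 < t ->
  padd (pscale rho (dir al)) (pscale t (dir (al + pi - p + phi))) <>
  pscale l (padd (pscale rho (dir al)) (pscale k (dir (al + pi - p + a * s)))).
Proof.
move=> r0 pI paI /andP[f0 f1]; have pi0 := pi_gt0 R.
have [fpi|fpi] := ltP pi phi.
  have [|e eI He] := @small_multiples a (Num.min (phi - pi) (2 * pi - phi)).
    by rewrite lt_min; lra.
  exists e => // s k l t sI k0 l1 t0.
  have /andP[b1 b2] := He s sI.
  have b3 : Num.min (phi - pi) (2 * pi - phi) <= phi - pi by rewrite ge_min lexx.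
  have b4 : Num.min (phi - pi) (2 * pi - phi) <= 2 * pi - phi by rewrite ge_min lexx orbT.
  have s1 : 0 <= s <= 1 by lra.
  have sw := sin_wedge_ge0 pI paI s1.
  set u := dir (al + pi - p + a * s).
  move=> /(congr1 (fun w => cross w (pscale 1 u))).
  rewrite crossZl !crossDl !cross_dir subrr sin0 mulr0 addr0 !mulr1.
  have -> : al + pi - p + a * s - al = pi - (p - a * s) by ring.
  have -> : al + pi - p + a * s - (al + pi - p + phi) = pi - (phi - a * s - pi) - 2 * pi by ring.
  rewrite sinB2pi !sinpiB.
  have sp : 0 < sin (phi - a * s - pi) by apply: sin_gt0_pi; lra.
  have h1 : 0 < t * sin (phi - a * s - pi) by exact: mulr_gt0.
  have h2 : 0 <= (1 - l) * (rho * sin (p - a * s)).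
    by rewrite !mulr_ge0 // ?subr_ge0 ?(andP l1).2 ?(ltW r0) //; lra.
  by lra.
have [|e eI He] := @small_multiples a (pi / 2); first by lra.
exists e => // s k l t sI k0 /andP[l0 l1] t0 h.
have s1 : 0 <= s <= 1 by lra.
have sw := sin_wedge_ge0 pI paI s1.
(* Testing against the radius removes the vertex and leaves [- t sin (phi - p) = l k sin (p - a s)],
   impossible if [phi - p < pi]. *)
have := congr1 (fun w => cross (pscale 1 (dir al)) w) h.
rewrite crossZr !crossDr !cross_dir subrr sin0 mulr0 !add0r !mul1r.
have -> : al + pi - p + a * s - al = pi - (p - a * s) by ring.
have -> : al + pi - p + phi - al = pi - - (phi - p) by ring.
rewrite !sinpiB sinN => h1.
have [pf|pf] := ltP (phi - p) pi.
  have sp : 0 < sin (phi - p) by apply: sin_gt0_pi; lra.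
  have h2 : 0 < t * sin (phi - p) by exact: mulr_gt0.
  have : 0 <= l * (k * sin (p - a * s)) by rewrite !mulr_ge0.
  by lra.
(* In the remaining case the ray points radially outwards, and the radial components contradict each
   other: [rho + t] against at most [rho]. *)
have p00 : p = 0 by lra.
have phipi : phi = pi by lra.
have := congr1 (fun w => cos al * w.1 + sin al * w.2) h.
rewrite p00 phipi subr0.
have -> : al + pi + pi = al + 2 * pi by ring.
rewrite dirD2pi.
have -> : al + pi + a * s = (al + a * s) + pi by ring.
rewrite dirDpi /padd /pscale /dir /=.
have e1 := cos2Dsin2 al.
move=> h2.
have : (rho + t) * (cos al ^+ 2 + sin al ^+ 2) =
   l * (rho * (cos al ^+ 2 + sin al ^+ 2) - k * cos (al + a * s - al)).
  by rewrite cosB; transitivity (cos al * (rho * cos al + t * cos al) +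
     sin al * (rho * sin al + t * sin al)); [ring|rewrite h2; ring].
rewrite e1 !mulr1 addrAC subrr add0r => h3.
have : 0 < cos (a * s) by apply: cos_gt0_pihalf; exact: He.
move=> ca; have h4 : 0 <= l * (k * cos (a * s)) by rewrite !mulr_ge0 // ltW.
have h5 : 0 <= (1 - l) * rho by rewrite mulr_ge0 ?subr_ge0 // ltW.
by lra.
Qed.

Lemma dirD_congr (x y u : R) : dir x = dir y -> dir (x + u) = dir (y + u).
Proof. by rewrite /dir !cosD !sinD => -[-> ->]. Qed.

Definition mirror (w : R * R) : R * R := (w.1, - w.2).

(** Reflection exchanges the two senses of rotation, so the estimates for an outgoing arc apply to
    the incoming one. *)
Lemma mirror_arc be q rho t l k x y :
  padd (pscale rho (dir be)) (pscale t (dir (be + pi + q - x))) =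
    pscale l (padd (pscale rho (dir be)) (pscale k (dir (be + pi + q - y)))) ->
  padd (pscale rho (dir (- be))) (pscale t (dir (- be + pi - q + x))) =
    pscale l (padd (pscale rho (dir (- be))) (pscale k (dir (- be + pi - q + y)))).
Proof.
have md g : dir (- be + pi - q + g) = mirror (dir (be + pi + q - g)).
  have -> : mirror (dir (be + pi + q - g)) = dir (- (be + pi + q - g)).
    by rewrite /mirror /dir cosN sinN.
  by rewrite -[RHS]dirD2pi; congr dir; ring.
move=> /(congr1 mirror) h; rewrite !md.
move: h; rewrite /mirror /padd /pscale /dir /= cosN sinN => -[-> h2].
congr (_, _); rewrite !mulrN -!opprD h2; ring.
Qed.

End VertexAnalysis.

(** * The polygon built from split angles and balanced sectors *)

Section StarPolygon.
Variables (R : realType) (n : nat) (p q c : 'I_n -> R).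
Hypothesis n2 : (1 < n)%N.
Let d i := (p i - q (nxt i)) / 2.
Hypothesis p_ge0 : forall i, 0 <= p i.
Hypothesis q_ge0 : forall i, 0 <= q i.
Hypothesis pq_le : forall i, p i + q i <= pi.
Hypothesis c_gt0 : forall i, 0 < c i.
Hypothesis cd_lt : forall i, c i + `|d i| < pi / 2.
Hypothesis sum_c : \sum_i c i = pi.
Hypothesis balanced : \prod_i cos (c i - d i) = \prod_i cos (c i + d i).

Definition star_angle (k : nat) : R := \sum_(i < n | (i < k)%N) 2 * c i.
(** Starts at 1 and accumulates the ratios prescribed by [ed_rr']; [balanced] brings it back to 1 at
    [n]. *)
Definition star_radius (k : nat) : R :=
  \prod_(i < n | (i < k)%N) (cos (c i - d i) / cos (c i + d i)).
Definition star_vertex (i : 'I_n) : R * R :=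
  pscale (star_radius i) (dir (star_angle i)).
(** The choice of [d] makes the bends demanded by [ed_pa] and [ed_qa] agree. *)
Definition star_bend (i : 'I_n) : R := p i - pi / 2 + c i - d i.

Local Notation Psi := star_angle.
Local Notation rho := star_radius.
Local Notation v := star_vertex.
Local Notation a := star_bend.

Lemma cos_cd_gt0 i : 0 < cos (c i + d i) /\ 0 < cos (c i - d i).
Proof.
have := cd_lt i; have := c_gt0 i; have := ler_norm (d i); have := ler_norm (- d i).
by rewrite normrN => *; split; apply: cos_gt0_pihalf; lra.
Qed.

Lemma star_angle0 : Psi 0%N = 0.
Proof. by rewrite /Psi big1. Qed.

Lemma star_anglen : Psi n = 2 * pi.
Proof. by rewrite /Psi -sum_c mulr_sumr; apply: eq_bigl => i; rewrite ltn_ord. Qed.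

Lemma star_angleS (i : 'I_n) : Psi i.+1 = Psi i + 2 * c i.
Proof.
rewrite /Psi (bigD1 i) //= addrC; congr (_ + _); apply: eq_bigl => j.
by rewrite ltnS ltn_neqAle andbC -val_eqE.
Qed.

Lemma star_radius_gt0 k : 0 < rho k.
Proof. by apply: prodr_gt0 => i _; have [h1 h2] := cos_cd_gt0 i; exact: divr_gt0. Qed.

Lemma star_radius0 : rho 0%N = 1.
Proof. by rewrite /rho big1. Qed.

Lemma star_radiusn : rho n = 1.
Proof.
rewrite /rho.
have -> : \prod_(i < n | (i < n)%N) (cos (c i - d i) / cos (c i + d i)) =
  \prod_(i < n) (cos (c i - d i) / cos (c i + d i)).
  by apply: eq_bigl => i; rewrite ltn_ord.
rewrite prodf_div balanced divff // gt_eqF //.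
by apply: prodr_gt0 => i _; have [] := cos_cd_gt0 i.
Qed.

Lemma star_radiusS (i : 'I_n) : rho i.+1 = rho i * (cos (c i - d i) / cos (c i + d i)).
Proof.
rewrite /rho (bigD1 i) //= mulrC; congr (_ * _); apply: eq_bigl => j.
by rewrite ltnS ltn_neqAle andbC -val_eqE.
Qed.

(** Only directions are compared, since at the last index the angles are 0 and [2 * pi]. *)
Lemma star_nxt (i : 'I_n) :
  rho (nxt i) = rho i.+1 /\ dir (Psi (nxt i)) = dir (Psi i.+1).
Proof.
have [h|h] := ltnP i.+1 n; first by rewrite /= modn_small.
have e : i.+1 = n by apply/eqP; rewrite eqn_leq h ltn_ord.
rewrite /= e modnn star_radius0 star_radiusn star_angle0 star_anglen; split=> //.
by rewrite -[X in _ = dir X]add0r dirD2pi.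
Qed.

Lemma star_vertex_nxt i : v (nxt i) = pscale (rho i.+1) (dir (Psi i.+1)).
Proof. by have [h1 h2] := star_nxt i; rewrite /v h1 h2. Qed.

Lemma star_edge_data (i : 'I_n) : edge_data (rho i) (rho i.+1) (c i) (d i) (p i) (q (nxt i)) (a i).
Proof.
have [h1 h2] := cos_cd_gt0 i.
have := p_ge0 i; have := q_ge0 i; have := pq_le i.
have := p_ge0 (nxt i); have := q_ge0 (nxt i); have := pq_le (nxt i) => *.
split; rewrite ?star_radius_gt0 //; try lra.
- by rewrite star_radiusS; field; rewrite gt_eqF.
- by rewrite /a /d; lra.
Qed.

Lemma star_point0 i : arc_point (v i) (v (nxt i)) (a i) 0 = v i.
Proof.
rewrite star_vertex_nxt star_angleS.
exact: (edge_point0 _ (star_edge_data i)).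
Qed.

Lemma star_point1 i : arc_point (v i) (v (nxt i)) (a i) 1 = v (nxt i).
Proof.
rewrite star_vertex_nxt star_angleS.
exact: (edge_point1 _ (star_edge_data i)).
Qed.

Lemma star_cross_gt0 i (s t : R) : 0 <= s -> s < t -> t <= 1 ->
  0 < cross (arc_point (v i) (v (nxt i)) (a i) s) (arc_point (v i) (v (nxt i)) (a i) t).
Proof.
rewrite star_vertex_nxt star_angleS.
exact: (edge_cross_gt0 _ (star_edge_data i)).
Qed.

Lemma star_angle_step k : (k < n)%N -> 0 < Psi k.+1 - Psi k < pi.
Proof.
move=> kn; rewrite (star_angleS (Ordinal kn)) addrAC subrr add0r.
exact: (edge_2c (star_edge_data (Ordinal kn))).
Qed.

Let unique := ray_unique star_angle0 star_anglen star_angle_step star_radius_gt0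
  (fun i => erefl (v i)) star_vertex_nxt star_point0 star_point1 star_cross_gt0.

Lemma nxt_neq (i : 'I_n) : nxt i != i.
Proof.
apply/eqP => /(congr1 val) /=.
have [h|h] := ltnP i.+1 n; first by rewrite modn_small // => /eqP; rewrite eqn_leq ltnn.
have e : i.+1 = n by apply/eqP; rewrite eqn_leq h ltn_ord.
by rewrite e modnn => h0; move: n2; rewrite -e -h0.
Qed.

Lemma star_simple : simple v a.
Proof.
split=> [i|i j ij z].
  have aI := edge_angle (star_edge_data i); split=> //.
  apply/eqP => vE; have := star_cross_gt0 i (lexx 0) ltr01 (lexx 1).
  by rewrite star_point0 star_point1 -vE crossuu ltxx.
move=> [s sI sE] [t tI tE]; move: sI tI; rewrite /= !in_itv /= => sI tI.
have h : arc_point (v i) (v (nxt i)) (a i) s =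
  pscale 1 (arc_point (v j) (v (nxt j)) (a j) t) by rewrite pscale1 sE tE.
have [[ijE _]|[jE s1 t0]|[iE s0 t1]] := unique sI tI ltr01 h.
- by rewrite ijE eqxx in ij.
- by left; split=> //; rewrite -tE t0 star_point0.
- by right; split=> //; rewrite -sE s0 star_point0.
Qed.

Let far := far_rays star_cross_gt0.

(** [B] selects the levels to be avoided: [1 <= l] for rays going inside, [0 <= l <= 1] for rays
    going outside. Initial pieces of the two incident arcs are left to the hypotheses; no positive
    multiple of the rest of the curve passes through [v i], so [far_rays] applies there. *)
Lemma vertex_avoid (i : 'I_n) (B : R -> Prop) (w : R * R) :
  (forall l, B l -> 0 <= l) ->
  (exists2 e, 0 < e <= 1 & forall s k l t, 0 <= s <= e -> 0 <= k -> B l -> 0 < t ->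
    padd (v i) (pscale t w) <>
    pscale l (padd (v i) (pscale k (dir (Psi i + pi - p i + a i * s))))) ->
  (exists2 e, 0 < e <= 1 & forall s k l t, 0 <= s <= e -> 0 <= k -> B l -> 0 < t ->
    padd (v i) (pscale t w) <>
    pscale l (padd (v i) (pscale k (dir (Psi i + pi + q i - a (prv i) * s))))) ->
  exists2 e, 0 < e & forall t, 0 < t < e -> forall j s l, 0 <= s <= 1 -> B l ->
    padd (v i) (pscale t w) <> pscale l (arc_point (v j) (v (nxt j)) (a j) s).
Proof.
move=> B0 [e1 /andP[e10 e11] H1] [e2 /andP[e20 e21] H2].
have vn0 : v i <> (0, 0) by apply: pscale_dir_neq0; rewrite gt_eqF // star_radius_gt0.
suff : exists2 e, 0 < e & forall t, 0 < t < e -> forall j, (forall s l, 0 <= s <= 1 -> B l ->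
    padd (v i) (pscale t w) <> pscale l (arc_point (v j) (v (nxt j)) (a j) s)).
  by [].
apply: ray_common_eps => j.
have [->|ji] := eqVneq j i.
  have E := star_edge_data i.
  have disj (s l : R) : e1 <= s <= 1 -> 0 < l ->
      v i <> pscale l (arc_point (v i) (v (nxt i)) (a i) s).
    move=> /andP[s0 s1] l0 h.
    have s0' : 0 < s by lra.
    have := star_cross_gt0 i (lexx 0) s0' s1.
    by rewrite star_point0 {1}h crossZl crossuu mulr0 ltxx.
  have [e e0 He] := @far i (v i) w e1 1 (ltW e10) (lexx 1) vn0 disj.
  exists e => // t tI s l sI Bl.
  have [se|se] := leP s e1; last by apply: He => //; [lra|exact: B0].
  rewrite star_vertex_nxt star_angleS (edge_pointE _ E).
  apply: H1 => //; [lra|apply: mulr_ge0|lra].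
    by apply/ltW; exact: (edge_length_gt0 E).
  by apply: arc_coef_ge0 => //; exact: (edge_angle E).
have ki : nxt (prv i) = i by exact: ord_predK.
have [->|jk] := eqVneq j (prv i).
  have E := star_edge_data (prv i).
  have disj (s l : R) : 0 <= s <= 1 - e2 -> 0 < l ->
      v i <> pscale l (arc_point (v (prv i)) (v (nxt (prv i))) (a (prv i)) s).
    move=> /andP[s0 s1] l0 h.
    have s0' : s < 1 by lra.
    have := star_cross_gt0 (prv i) s0 s0' (lexx 1).
    have e : cross (arc_point (v (prv i)) (v (nxt (prv i))) (a (prv i)) s)
       (pscale l (arc_point (v (prv i)) (v (nxt (prv i))) (a (prv i)) s)) = 0.
      by rewrite crossZr crossuu mulr0.
    have vi : arc_point (v (prv i)) (v (nxt (prv i))) (a (prv i)) 1 = v i.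
      by rewrite star_point1 ki.
    by rewrite vi; rewrite -h in e; rewrite e ltxx.
  have e2' : 1 - e2 <= 1 by lra.
  have [e e0 He] := @far (prv i) (v i) w 0 (1 - e2) (lexx 0) e2' vn0 disj.
  exists e => // t tI s l sI Bl.
  have [se|se] := leP s (1 - e2); first by apply: He => //; [lra|exact: B0].
  rewrite star_vertex_nxt star_angleS (edge_point_revE _ E).
  rewrite -star_angleS -star_vertex_nxt ki.
  have -> : dir (Psi (prv i).+1 + pi + q i - a (prv i) * (1 - s)) =
    dir (Psi i + pi + q i - a (prv i) * (1 - s)).
    rewrite -!addrA; apply: dirD_congr; have [_ <-] := star_nxt (prv i).
    by rewrite ki.
  apply: H2 => //; [lra|apply: mulr_ge0|lra].
    by apply/ltW; exact: (edge_length_gt0 E).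
  by apply: arc_coef_ge0; [exact: (edge_angle E)|lra].
have disj (s l : R) : 0 <= s <= 1 -> 0 < l ->
    v i <> pscale l (arc_point (v j) (v (nxt j)) (a j) s).
  move=> sI l0 h; rewrite -(star_point0 i) in h.
  have I0 : 0 <= (0 : R) <= 1 by rewrite lexx ler01.
  have [[ij _]|[_ /eqP]|[ij _ _]] := unique I0 sI l0 h.
  - by rewrite ij eqxx in ji.
  - by rewrite eq_sym oner_eq0.
  - by rewrite ij /prv ordSK eqxx in jk.
have [e e0 He] := @far j (v i) w 0 1 (lexx 0) (lexx 1) vn0 disj.
by exists e => // t tI s l sI Bl; apply: He => //; exact: B0.
Qed.

(** The tangents have polar angles [Psi i + pi - p i] and [Psi i + pi + q i], so the positive turn
    between them crosses the radius towards the origin. Once the unwanted levels are avoided, the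
    trichotomy decides the region. *)
Lemma star_interior_angle i : interior_angle v a i (p i + q i).
Proof.
have pi0 := pi_gt0 R.
have E := star_edge_data i; have Ek := star_edge_data (prv i).
have ki : nxt (prv i) = i by exact: ord_predK.
have p0 := p_ge0 i; have q0 := q_ge0 i; have pq := pq_le i.
have r0 := star_radius_gt0 i.
have [l l0 out] : exists2 l, 0 < l & tan_out v a i = pscale l (dir (Psi i + pi - p i)).
  exists (rho i * sin (2 * c i) / cos (c i + d i)); first exact: (edge_length_gt0 E).
  by rewrite /tan_out star_vertex_nxt star_angleS (edge_tan_out _ E).
have [m m0 inn] : exists2 m, 0 < m & tan_in v a i = pscale m (dir (Psi i + pi + q i)).
  exists (rho (prv i) * sin (2 * c (prv i)) / cos (c (prv i) + d (prv i))).
    exact: (edge_length_gt0 Ek).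
  have <- : dir (Psi (prv i).+1 + pi + q i) = dir (Psi i + pi + q i).
    rewrite -!addrA; apply: dirD_congr; have [_ <-] := star_nxt (prv i).
    by rewrite ki.
  have vi : v i = pscale (rho (prv i).+1) (dir (Psi (prv i).+1)).
    by rewrite -star_vertex_nxt ki.
  by rewrite /tan_in vi star_angleS (edge_tan_in _ Ek) ki.
have [inU outV] := star_regions n2 star_angle0 star_anglen star_angle_step star_radius_gt0
  (fun i => erefl (v i)) star_vertex_nxt star_point0 star_point1 star_cross_gt0.
have tri := star_trichotomy n2 star_angle0 star_anglen star_angle_step star_radius_gt0
  (fun i => erefl (v i)) star_vertex_nxt star_point0 star_point1 star_cross_gt0.
have qI : 0 <= q i <= pi by lra.
have pa : 0 <= p i - a i <= pi.
  by rewrite /a; have := edge_bounds E; case; lra.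
have qa : 0 <= q i - a (prv i) <= pi.
  have := ed_qa Ek; rewrite ki => ->.
  by have := edge_bounds Ek; case; lra.
have rotE phi t : padd (v i) (pscale t (rot (1 * phi) (tan_out v a i))) =
    padd (v i) (pscale (t * l) (dir (Psi i + pi - p i + phi))).
  by rewrite out rot_pscale_dir pscaleA mul1r [phi + _]addrC.
have mir rr th t ll k s phi x : dir (Psi i + pi - p i + phi) = dir (Psi i + pi + q i - x) ->
   padd (pscale rr (dir (Psi i))) (pscale t (dir (Psi i + pi - p i + phi))) =
   pscale ll (padd (pscale rr (dir (Psi i))) (pscale k (dir (Psi i + pi + q i - th * s)))) ->
   padd (pscale rr (dir (- Psi i))) (pscale t (dir (- Psi i + pi - q i + x))) =
   pscale ll (padd (pscale rr (dir (- Psi i))) (pscale k (dir (- Psi i + pi - q i + th * s)))).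
  by move=> ->; exact: mirror_arc.
split; first by lra.
exists 1; split; first by left.
split; [|split].
- exists (l / m); split; first exact: divr_gt0.
  rewrite out inn mul1r rot_pscale_dir pscaleA divfK ?gt_eqF //.
  by congr (pscale _ (dir _)); ring.
- move=> phi /andP[f0 f1].
  have [|||e e0 He] := @vertex_avoid i (fun l => 1 <= l) (dir (Psi i + pi - p i + phi)).
  + by move=> x x1; lra.
  + by apply: arc_avoid_in => //; lra.
  (* In the reflected picture the incoming arc becomes outgoing, and the ray makes this angle with
     its tangent. *)
  + have fI : 0 < p i + q i - phi < pi by lra.
    have [e eI He] := @arc_avoid_in R (- Psi i) (q i) (a (prv i)) (rho i)
       (p i + q i - phi) r0 qI qa fI.
    exists e => // s k l' t sI k0 l1 t0.
    move=> h; apply: (He s k l' t) => //; apply: (mir _ _ _ _ _ _ phi _ _ h).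
    by congr dir; ring.
  exists (e / l); split; first exact: divr_gt0.
  move=> t /andP[t0]; rewrite ltr_pdivlMr // => te.
  rewrite rotE; have tlI : 0 < t * l < e by rewrite te mulr_gt0.
  apply: inU; set W := padd _ _; have [//|[/curveP[j [s [sI h]]]|[j [s [l' [sI l1 h]]]]]] := tri W.
  + by case: (He _ tlI j s 1 sI (lexx _)); rewrite pscale1.
  + by case: (He _ tlI j s l' sI (ltW l1)).
- move=> phi /andP[f0 f1].
  have [|||e e0 He] := @vertex_avoid i (fun l => 0 <= l <= 1) (dir (Psi i + pi - p i + phi)).
  + by move=> x /andP[].
  + by apply: arc_avoid_out => //; lra.
  (* A full turn is added to bring the reflected angle into the range of [arc_avoid_out]. *)
  + have fI : q i < p i + q i - phi + 2 * pi < 2 * pi by lra.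
    have [e eI He] := @arc_avoid_out R (- Psi i) (q i) (a (prv i)) (rho i)
       (p i + q i - phi + 2 * pi) r0 qI qa fI.
    exists e => // s k l' t sI k0 l1 t0.
    move=> h; apply: (He s k l' t) => //; apply: (mir _ _ _ _ _ _ phi _ _ h).
    by rewrite -[RHS]dirD2pi; congr dir; ring.
  exists (e / l); split; first exact: divr_gt0.
  move=> t /andP[t0]; rewrite ltr_pdivlMr // => te.
  rewrite rotE; have tlI : 0 < t * l < e by rewrite te mulr_gt0.
  apply: outV; set W := padd _ _; have [[j [s [l' [sI /andP[l0' l1] h]]]]|[/curveP[j [s [sI h]]]|//]] := tri W.
  + by case: (He _ tlI j s l' sI); rewrite ?l0' ?(ltW l1).
  + by case: (He _ tlI j s 1 sI); rewrite ?pscale1 ?ler01 ?lexx.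
Qed.

End StarPolygon.

(** * Closing up *)

Section Balance.
Variables (R : realType) (n : nat) (d : 'I_n -> R).
Hypothesis d_small : forall i, `|d i| < pi / 2.
Hypothesis sum_d : \sum_i d i = 0.
Let M i := pi / 2 - `|d i|.
Hypothesis sum_M : pi < \sum_i M i.

Let S := \sum_i M i.

(* The configuration of total pi in which the j-th sector is as wide as it can be. *)
Let extremal (j i : 'I_n) : R := if i == j then M j else (pi - M j) / (S - M j) * M i.

Let M_bounds i : 0 < M i <= pi / 2.
Proof. by rewrite /M; have := d_small i; have := normr_ge0 (d i); lra. Qed.

Let ratio_bounds j : 0 < (pi - M j) / (S - M j) < 1.
Proof.
have pi0 := pi_gt0 R; have := M_bounds j => Mj; have := sum_M; rewrite -/S => h.
have D0 : 0 < S - M j by lra.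
by rewrite divr_gt0 ?ltr_pdivrMr ?mul1r //; lra.
Qed.

Let sum_extremal j : \sum_i extremal j i = pi.
Proof.
have pi0 := pi_gt0 R; have := M_bounds j => Mj; have := sum_M; rewrite -/S => h.
have D0 : S - M j != 0 by apply: lt0r_neq0; lra.
rewrite (bigD1 j) //= {1}/extremal eqxx.
rewrite (eq_bigr (fun i => (pi - M j) / (S - M j) * M i)); last first.
  by move=> i /negbTE ij; rewrite /extremal ij.
have e : \sum_(i < n | i != j) M i = S - M j.
  by rewrite /S [in RHS](bigD1 j) //= addrAC subrr add0r.
by rewrite -mulr_sumr e divfK //; ring.
Qed.

Let extremal_bounds j i : 0 < extremal j i <= M i.
Proof.
have := ratio_bounds j; have := M_bounds i; rewrite /extremal; case: eqVneq => [->|_].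
  by move=> /andP[-> _]; rewrite lexx.
move=> /andP[m0 _] /andP[r0 r1]; rewrite mulr_gt0 //= ger_pMl // ltW //.
Qed.

Let extremal_lt j i : i != j -> extremal j i < M i.
Proof.
move=> /negbTE ij; rewrite /extremal ij.
have := ratio_bounds j; have /andP[m0 _] := M_bounds i; move=> /andP[_ r1].
by rewrite gtr_pMl.
Qed.

Let cos_gt0 i x : 0 < x -> x < M i -> 0 < cos (x - d i) /\ 0 < cos (x + d i).
Proof.
rewrite /M => x0 xM; have := ler_norm (d i); have := ler_norm (- d i).
by rewrite normrN => *; split; apply: cos_gt0_pihalf; lra.
Qed.

Let gap (c : 'I_n -> R) := \prod_i cos (c i - d i) - \prod_i cos (c i + d i).

(** The widest [j]-th sector has [c j + d j = pi / 2], so the subtracted product vanishes while the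
    other one has positive factors. *)
Let gap_extremal_gt0 j : 0 < d j -> 0 < gap (extremal j).
Proof.
move=> dj; have nd : `|d j| = d j by rewrite ger0_norm // ltW.
have e0 : \prod_i cos (extremal j i + d i) = 0.
  rewrite (bigD1 j) //= /extremal eqxx /M nd subrK cos_pihalf mul0r //.
rewrite /gap e0 subr0; apply: prodr_gt0 => i _.
have [->|ij] := eqVneq i j; last first.
  by have /andP[x0 _] := extremal_bounds j i; have [] := cos_gt0 x0 (extremal_lt ij).
rewrite /extremal eqxx /M nd; apply: cos_gt0_pihalf.
by have := d_small j; rewrite nd; lra.
Qed.

Let gap_extremal_lt0 j : d j < 0 -> gap (extremal j) < 0.
Proof.
move=> dj; have nd : `|d j| = - d j by rewrite ltr0_norm.
have e0 : \prod_i cos (extremal j i - d i) = 0.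
  rewrite (bigD1 j) //= /extremal eqxx /M nd opprK addrK cos_pihalf mul0r //.
rewrite /gap e0 sub0r oppr_lt0; apply: prodr_gt0 => i _.
have [->|ij] := eqVneq i j; last first.
  by have /andP[x0 _] := extremal_bounds j i; have [] := cos_gt0 x0 (extremal_lt ij).
rewrite /extremal eqxx /M nd; apply: cos_gt0_pihalf.
by have := d_small j; rewrite nd; lra.
Qed.

Lemma continuous_prod (I : Type) (r : seq I) (f : I -> R -> R) :
  (forall i, continuous (f i)) -> continuous (fun x => \prod_(i <- r) f i x).
Proof.
move=> cf; elim: r => [|i r IH].
  have -> : (fun x => \prod_(i <- [::]) f i x) = fun=> 1 by apply/funext => x; rewrite big_nil.
  by move=> x; exact: cst_continuous.
have -> : (fun x => \prod_(j <- i :: r) f j x) = fun x => f i x * \prod_(j <- r) f j x.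
  by apply/funext => x; rewrite big_cons.
by move=> x; apply: (@continuousM R _ (f i)); [exact: cf|exact: IH].
Qed.

Let mix (j k : 'I_n) (x : R) (i : 'I_n) := extremal j i + x * (extremal k i - extremal j i).

Let continuous_gap j k : continuous (fun x => gap (mix j k x)).
Proof.
have cc i (e : R) : continuous (fun x => cos (mix j k x i + e)).
  have cl : continuous (fun x : R => mix j k x i + e).
    move=> x; apply: (@continuousD _ R R (fun x => mix j k x i) (fun=> e)); last exact: cst_continuous.
    apply: (@continuousD _ R R (fun=> extremal j i) (fun x => x * (extremal k i - extremal j i))).
      exact: cst_continuous.
    by apply: (@continuousM R _ id (fun=> extremal k i - extremal j i));
      [exact: cvg_id|exact: cst_continuous].
  by move=> x; apply: (@continuous_comp _ _ _ (fun x => mix j k x i + e) cos);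
    [exact: cl|exact: continuous_cos].
move=> x; apply: (@continuousB _ R R (fun x => \prod_i cos (mix j k x i - d i))
   (fun x => \prod_i cos (mix j k x i + d i))).
- by apply: (continuous_prod (f := fun i x => cos (mix j k x i - d i))) => i; exact: cc.
- by apply: (continuous_prod (f := fun i x => cos (mix j k x i + d i))) => i; exact: cc.
Qed.

(** Intermediate value theorem for [gap] on the segment between two extremal configurations, one for
    a positive and one for a negative [d]; the total [pi] is preserved along it. *)
Lemma balanced_sectors : exists c : 'I_n -> R,
  [/\ forall i, 0 < c i, forall i, c i + `|d i| < pi / 2, \sum_i c i = pi &
      \prod_i cos (c i - d i) = \prod_i cos (c i + d i)].
Proof.
have pi0 := pi_gt0 R.
have [[j dj]|npos] := pselect (exists j, 0 < d j); last first.
  (* Without a positive [d] the zero sum makes all of them vanish. Both products then agree for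
     every [c], and the bounds [M] are just scaled down to total [pi]. *)
  have d0 i : d i = 0.
    have le0 k : 0 <= - d k.
      by rewrite oppr_ge0 leNgt; apply/negP => dk; apply: npos; exists k.
    have s0 : \sum_k - d k = 0 by rewrite sumrN sum_d oppr0.
    have /eqP := s0; rewrite psumr_eq0 => [/allP /(_ i (mem_index_enum _))|k _]; last exact: le0.
    by rewrite oppr_eq0 => /eqP.
  have S0 : 0 < S by rewrite (lt_trans pi0) // sum_M.
  exists (fun i => pi / S * M i); split.
  - by move=> i; rewrite mulr_gt0 ?divr_gt0 //; have /andP[] := M_bounds i.
  - move=> i; have /andP[m0 _] := M_bounds i.
    rewrite -ltrBrDr -/(M i) gtr_pMl // ltr_pdivrMr // mul1r; exact: sum_M.
  - by rewrite -mulr_sumr -/S divfK // gt_eqF.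
  - by apply: eq_bigr => i _; rewrite d0 subr0 addr0.
have [[k dk]|nneg] := pselect (exists k, d k < 0); last first.
  have ge0 k : 0 <= d k.
    by rewrite leNgt; apply/negP => dk; apply: nneg; exists k.
  have := sum_d; rewrite (bigD1 j) //=.
  have : 0 <= \sum_(i < n | i != j) d i by apply: sumr_ge0.
  by lra.
have g1 := gap_extremal_gt0 dj; have g2 := gap_extremal_lt0 dk.
have jk : j != k by apply/eqP => jk; move: dj dk; rewrite jk; lra.
have m0 : mix j k 0 = extremal j by apply/funext => i; rewrite /mix mul0r addr0.
have m1 : mix j k 1 = extremal k by apply/funext => i; rewrite /mix mul1r; ring.
have [||||x /andP[x0 x1] gx] := @IVT_decr R (fun x => gap (mix j k x)) 0 1.
- exact: ler01.
- exact: continuous_gap.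
- by rewrite m0 ltW.
- by rewrite m1 ltW.
(* The zero is not at an end, so each sector mixes two extremal values, at least one of which is
   strictly below its bound. *)
have xn0 : x != 0 by apply/eqP => xE; move: gx; rewrite xE m0; lra.
have xn1 : x != 1 by apply/eqP => xE; move: gx; rewrite xE m1; lra.
have {}x0 : 0 < x by rewrite lt_neqAle eq_sym xn0.
have {}x1 : x < 1 by rewrite lt_neqAle xn1.
exists (mix j k x); split.
- move=> i; rewrite /mix; have /andP[e1 _] := extremal_bounds j i.
  have /andP[e2 _] := extremal_bounds k i.
  have h1 : 0 < (1 - x) * extremal j i by rewrite mulr_gt0 // subr_gt0.
  by have h2 : 0 < x * extremal k i; [exact: mulr_gt0|lra].
- move=> i; rewrite -ltrBrDr -/(M i) /mix.
  have /andP[_ e1] := extremal_bounds j i; have /andP[_ e2] := extremal_bounds k i.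
  have h1 : 0 <= (1 - x) * (M i - extremal j i) by rewrite mulr_ge0 // subr_ge0 // ltW.
  have h2 : 0 <= x * (M i - extremal k i) by rewrite mulr_ge0 // ?subr_ge0 // ltW.
  have [ij|ij] := eqVneq i j.
    have h : extremal k i < M i by apply: extremal_lt; rewrite ij.
    have : 0 < x * (M i - extremal k i) by rewrite mulr_gt0 // subr_gt0.
    by lra.
  have h : extremal j i < M i := extremal_lt ij.
  have : 0 < (1 - x) * (M i - extremal j i) by rewrite mulr_gt0 // subr_gt0.
  by lra.
- by rewrite /mix big_split /= -mulr_sumr sumrB !sum_extremal; ring.
- by apply/eqP; rewrite -subr_eq0; apply/eqP.
Qed.

End Balance.

(** * The alternating quadrilateral *)

Definition realizable (R : realType) n (theta : 'I_n -> R) :=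
  exists (v : 'I_n -> R * R) (a : 'I_n -> R),
    simple v a /\ forall i, interior_angle v a i (theta i).

(** A cyclic relabelling changes neither the curve nor its regions. It reduces the angles (pi, 0,
    pi, 0) to (0, pi, 0, pi). *)
Lemma realizable_nxt (R : realType) n (theta : 'I_n -> R) :
  realizable theta -> realizable (theta \o @nxt n).
Proof.
move=> [v [a [[wf sp] ang]]].
have cE : curve (v \o @nxt n) (a \o @nxt n) = curve v a.
  apply/seteqP; split=> z [i _ zi]; first by exists (nxt i).
  by exists (prv i) => //; rewrite /edge /= (ord_predK i : nxt (prv i) = i).
exists (v \o @nxt n), (a \o @nxt n); split.
  split=> [i|i j ij z zi zj]; first exact: wf.
  have nij : nxt i != nxt j by apply: contra_neq ij; exact: ordS_inj.
  have [[/ordS_inj e ->]|[/ordS_inj e ->]] := sp _ _ nij _ zi zj.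
  - by left.
  - by right.
have iE : interior_of (v \o @nxt n) (a \o @nxt n) = interior_of v a.
  by rewrite /interior_of cE.
have eE : exterior_of (v \o @nxt n) (a \o @nxt n) = exterior_of v a.
  by rewrite /exterior_of cE iE.
move=> i; have := ang (nxt i); rewrite /interior_angle iE eE.
have -> : tan_in (v \o @nxt n) (a \o @nxt n) i = tan_in v a (nxt i).
  rewrite /tan_in /= (ord_predK i : nxt (prv i) = i).
  by rewrite (ordSK i : prv (nxt i) = i).
exact.
Qed.

Section Quadrilateral.
Variable R : realType.
Implicit Types (z d : R * R) (t c : R).

(** Interpolating sine and cosine expresses the coefficient at [t] through the one at [1 - t]. *)
Lemma arc_point_rev (u w : R * R) (a t : R) : - pi < a < pi ->
  arc_point w u (- a) t = arc_point u w a (1 - t).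
Proof.
move=> aI; rewrite /arc_point arc_coefN /padd /pscale /psub /rot /=.
have -> : - a * (t - 1) = a * (1 - t) by ring.
have -> : a * (1 - t - 1) = - (a * t) by ring.
rewrite sinN cosN.
have i1 := sin_arc_interp t (a * t) aI.
have i2 := sin_arc_interp t (a * t + pi / 2) aI.
have e1 : a * t - a * t = 0 by ring.
have e2 : a * t + pi / 2 - a * t = 0 + pi / 2 by ring.
have e3 : a * t + pi / 2 - a = (a * t - a) + pi / 2 by ring.
have e4 : a * t - a = - (a * (1 - t)) by ring.
rewrite e1 e4 sinN sin0 in i1; rewrite e2 e3 e4 !sinDpihalf cos0 cosN in i2.
set ct := cos (a * t) in i1 i2 *; set st := sin (a * t) in i1 i2 *.
set cs := cos (a * (1 - t)) in i1 i2 *; set ss := sin (a * (1 - t)) in i1 i2 *.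
set C := arc_coef a t in i1 i2 *; set C' := arc_coef a (1 - t) in i1 i2 *.
congr (_, _).
- transitivity (u.1 + (1 - C * cs) * (w.1 - u.1) + C * ss * (w.2 - u.2)); first by ring.
  have -> : 1 - C * cs = C' * ct by lra.
  have -> : C * ss = C' * st by lra.
  by ring.
- transitivity (u.2 + (1 - C * cs) * (w.2 - u.2) - C * ss * (w.1 - u.1)); first by ring.
  have -> : 1 - C * cs = C' * ct by lra.
  have -> : C * ss = C' * st by lra.
  by ring.
Qed.

Lemma arc_set_rev (u w : R * R) (a : R) : - pi < a < pi ->
  arc_set w u (- a) = arc_set u w a.
Proof.
move=> aI; apply/seteqP; split=> z [t tI <-]; rewrite /= in_itv /= in tI.
- by exists (1 - t); rewrite ?arc_point_rev //= in_itv /=; lra.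
- exists (1 - t); first by rewrite /= in_itv /=; lra.
  by rewrite arc_point_rev //; congr arc_point; ring.
Qed.

(* The half-turn about the centre (3/2, 0) of the quadrilateral. *)
Definition half_turn z : R * R := (3 - z.1, - z.2).

Lemma half_turnK z : half_turn (half_turn z) = z.
Proof. by case: z => x y; rewrite /half_turn /=; congr (_, _); ring. Qed.

Lemma arc_set_half_turn (u w : R * R) (a : R) z :
  arc_set (half_turn u) (half_turn w) a z <-> arc_set u w a (half_turn z).
Proof.
have e t : arc_point (half_turn u) (half_turn w) a t = half_turn (arc_point u w a t).
  by rewrite /arc_point /half_turn /padd /pscale /psub /rot /=; congr (_, _); ring.
split=> [[t tI <-]|[t tI tz]]; exists t => //; first by rewrite e half_turnK.
by rewrite e tz half_turnK.
Qed.

Definition sqn z : R := z.1 ^+ 2 + z.2 ^+ 2.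
Definition lin z : R := z.1 + z.2.

Lemma cos_pi4 : cos (pi / 4) = sin (pi / 4) :> R.
Proof.
have e : (pi / 4 : R) = - (pi / 4) + pi / 2 by lra.
by rewrite [in LHS]e cosDpihalf sinN opprK.
Qed.

Lemma sin_pi4_gt0 : 0 < sin (pi / 4) :> R.
Proof. by have := pi_gt0 R => pi0; apply: sin_gt0_pi; lra. Qed.

Lemma pi4_bounds : - pi < (pi / 4 : R) < pi.
Proof. by have := pi_gt0 R; lra. Qed.

(** For [c > 0] the equation is the circle through the origin and [(c, 0)] with centre [(c/2, c/2)];
    the part below the axis is a quarter of it. *)
Definition lower_arc c z : Prop := z.2 <= 0 /\ sqn z = c * lin z.

(** The circle has polar equation [r = c (cos u + sin u)], and the arc runs through it linearly in
    the polar angle [u = pi / 4 * (t - 1)]. *)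
Lemma arc_pi4E c t : arc_point (0, 0) (c, 0) (pi / 4) t =
  pscale (c * (cos (pi / 4 * (t - 1)) + sin (pi / 4 * (t - 1)))) (dir (pi / 4 * (t - 1))).
Proof.
have s0 := sin_pi4_gt0; have sn0 : sin (pi / 4 : R) != 0 by rewrite gt_eqF.
have e : arc_coef (pi / 4) t = cos (pi / 4 * (t - 1)) + sin (pi / 4 * (t - 1)).
  apply: (mulfI sn0); rewrite (sinM_arc_coef _ pi4_bounds).
  have -> : pi / 4 * t = pi / 4 * (t - 1) + pi / 4 by ring.
  by rewrite sinD cos_pi4; ring.
by rewrite /arc_point e /padd /pscale /psub /rot /dir /=; congr (_, _); ring.
Qed.

Lemma lower_arcP c z : 0 < c -> arc_set (0, 0) (c, 0) (pi / 4) z <-> lower_arc c z.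
Proof.
move=> c0; have pi0 := pi_gt0 R; have s0 := sin_pi4_gt0; split.
  move=> [t]; rewrite /= in_itv /= => tI <-.
  have C0 := arc_coef_ge0 pi4_bounds tI.
  rewrite arc_pi4E; set u := pi / 4 * (t - 1).
  have h : 0 <= cos u + sin u.
    have sn0 : sin (pi / 4 : R) != 0 by rewrite gt_eqF.
    rewrite -(pmulr_rge0 _ s0); have -> : sin (pi / 4) * (cos u + sin u) = sin (u + pi / 4).
      by rewrite sinD cos_pi4; ring.
    by apply: sin_ge0_pi; rewrite /u; nra.
  have su : sin u <= 0.
    by rewrite -oppr_ge0 -sinN; apply: sin_ge0_pi; rewrite /u; nra.
  have e := cos2Dsin2 u.
  split; rewrite /sqn /lin /pscale /dir /=.
    by rewrite mulr_ge0_le0 // mulr_ge0 // ltW.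
  transitivity (c ^+ 2 * (cos u + sin u) ^+ 2 * (cos u ^+ 2 + sin u ^+ 2)); first by ring.
  by rewrite e; ring.
move=> [z2 zN].
have [->|zn0] := pselect (z = (0, 0)).
  exists 0; first by rewrite /= in_itv /= lexx ler01.
  by rewrite /arc_point arc_coef0 /padd /pscale /= !mul0r !addr0.
have L0 : 0 <= lin z.
  rewrite -(pmulr_rge0 _ c0) -zN /sqn addr_ge0 // sqr_ge0 //.
have [|||k [u [k0 uI zE]]] := @cone_dir R (- (pi / 4)) 0 z _ zn0.
- by lra.
- rewrite /cross /dir /= cosN sinN cos_pi4; move: L0; rewrite /lin => L0.
  have h : 0 <= sin (pi / 4) * (z.1 + z.2) by rewrite mulr_ge0 // ltW.
  by lra.
- by rewrite /cross /dir /= cos0 sin0; lra.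
have e := cos2Dsin2 u.
have kE : k = c * (cos u + sin u).
  move: zN; rewrite zE /sqn /lin /pscale /dir /= => zN.
  have kn0 : k != 0 by rewrite gt_eqF.
  apply: (mulfI kn0).
  transitivity ((k * cos u) ^+ 2 + (k * sin u) ^+ 2); last by rewrite zN; ring.
  transitivity (k ^+ 2 * (cos u ^+ 2 + sin u ^+ 2)); last by ring.
  by rewrite e mulr1.
(* The parameter solving [pi / 4 * (t - 1) = u]. *)
exists (1 + u / (pi / 4)).
  rewrite /= in_itv /=; apply/andP; split.
    rewrite -lerBlDl sub0r ler_pdivlMr; lra.
  by rewrite gerDl pmulr_lle0 ?invr_gt0; lra.
rewrite arc_pi4E zE.
have -> : pi / 4 * (1 + u / (pi / 4) - 1) = u.
  by rewrite addrAC subrr add0r mulrC divfK // gt_eqF //; lra.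
by rewrite -kE.
Qed.

(* The circles carrying the four edges are sqn = lin and sqn = 2 lin, and their
   images under the half-turn; the former carry the edges below the x-axis. *)
Definition quad_vertex (i : 'I_4) : R * R :=
  nth (0, 0) [:: (0, 0); (1, 0); (3, 0); (2, 0)] i.
Definition quad_bend (i : 'I_4) : R := if odd i then - (pi / 4) else pi / 4.

Local Notation v := quad_vertex.
Local Notation a := quad_bend.

Lemma I4_ind (P : 'I_4 -> Prop) :
  P (inord 0) -> P (inord 1) -> P (inord 2) -> P (inord 3) -> forall i, P i.
Proof.
move=> P0 P1 P2 P3 i; rewrite -(inord_val i).
by case: i => [[|[|[|[|//]]]] ?].
Qed.

Lemma nxt_inord4 k : (k < 4)%N -> nxt (inord k : 'I_4) = inord (k.+1 %% 4).
Proof. by move=> k4; apply: val_inj; rewrite /= !inordK // ltn_mod. Qed.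

Lemma prv_inord4 k : (k < 4)%N -> prv (inord k : 'I_4) = inord ((k + 3) %% 4).
Proof.
by move=> k4; apply: val_inj; rewrite /= !inordK ?ltn_mod // addnS.
Qed.

Lemma quad_vertexE k : (k < 4)%N -> v (inord k) = nth (0, 0) [:: (0, 0); (1, 0); (3, 0); (2, 0)] k.
Proof. by move=> k4; rewrite /v inordK. Qed.

Lemma quad_bendE k : (k < 4)%N -> a (inord k) = if odd k then - (pi / 4) else pi / 4.
Proof. by move=> k4; rewrite /a inordK. Qed.

Let half0 : half_turn (0, 0) = (3, 0).
Proof. by rewrite /half_turn /=; congr (_, _); ring. Qed.
Let half1 : half_turn (1, 0) = (2, 0).
Proof. by rewrite /half_turn /=; congr (_, _); ring. Qed.
Let half2 : half_turn (2, 0) = (1, 0).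
Proof. by rewrite /half_turn /=; congr (_, _); ring. Qed.

Lemma quad_edge0 z : edge v a (inord 0) z <-> lower_arc 1 z.
Proof.
rewrite /edge nxt_inord4 // !quad_vertexE //= quad_bendE //=.
by apply: lower_arcP; exact: ltr01.
Qed.

Lemma quad_edge3 z : edge v a (inord 3) z <-> lower_arc 2 z.
Proof.
rewrite /edge nxt_inord4 // !quad_vertexE //= quad_bendE //=.
by rewrite (arc_set_rev _ _ pi4_bounds); apply: lower_arcP; exact: ltr0n.
Qed.

Lemma quad_edge1 z : edge v a (inord 1) z <-> lower_arc 2 (half_turn z).
Proof.
rewrite -quad_edge3 /edge !nxt_inord4 // !quad_vertexE //= !quad_bendE //=.
by rewrite -arc_set_half_turn half0 half2.
Qed.

Lemma quad_edge2 z : edge v a (inord 2) z <-> lower_arc 1 (half_turn z).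
Proof.
rewrite -quad_edge0 /edge !nxt_inord4 // !quad_vertexE //= !quad_bendE //=.
by rewrite -arc_set_half_turn half0 half1.
Qed.

Lemma quad_curveP z : curve v a z <->
  (lower_arc 1 z \/ lower_arc 2 z) \/ (lower_arc 1 (half_turn z) \/ lower_arc 2 (half_turn z)).
Proof.
split=> [[i _]|].
  elim/I4_ind: i; [move/quad_edge0|move/quad_edge1|move/quad_edge2|move/quad_edge3]; tauto.
move=> [[/quad_edge0|/quad_edge3]|[/quad_edge2|/quad_edge1]] h;
  by [exists (inord 0)|exists (inord 3)|exists (inord 2)|exists (inord 1)].
Qed.

Lemma lower_arc_axis c z : lower_arc c z -> z.2 = 0 -> z.1 = 0 \/ z.1 = c.
Proof.
rewrite /lower_arc /sqn /lin => -[_ h] z2; rewrite z2 in h.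
have : z.1 * (z.1 - c) = 0 by lra.
by move/eqP; rewrite mulf_eq0 subr_eq0 => /orP[]/eqP; [left|right].
Qed.

Lemma lower_arc_half_axis c z : lower_arc c (half_turn z) -> z.2 = 0 ->
  3 - z.1 = 0 \/ 3 - z.1 = c.
Proof. by move=> h z2; apply: (lower_arc_axis h); rewrite /half_turn /= z2 oppr0. Qed.

(** The half-turn reverses the second coordinate, so such arcs can meet only on the axis. *)
Lemma lower_arc_half_turn c c' z : lower_arc c z -> lower_arc c' (half_turn z) ->
  z.2 = 0 /\ (z.1 = 0 \/ z.1 = c) /\ (3 - z.1 = 0 \/ 3 - z.1 = c').
Proof.
move=> h h'; have z2 : z.2 = 0.
  by move: h h' => [+ _] [+ _]; rewrite /half_turn /=; lra.
split=> //; split; first exact: (lower_arc_axis h).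
exact: (lower_arc_half_axis h').
Qed.

Lemma lower_arc12 z : lower_arc 1 z -> lower_arc 2 z -> z = (0, 0).
Proof.
rewrite /lower_arc /sqn => -[_ h1] [_ h2].
have z1 := sqr_ge0 z.1; have z2 := sqr_ge0 z.2.
have e1 : z.1 ^+ 2 = 0 by lra.
have e2 : z.2 ^+ 2 = 0 by lra.
move/eqP: e1; move/eqP: e2; rewrite !sqrf_eq0 => /eqP e2 /eqP e1.
by rewrite [z]surjective_pairing e1 e2.
Qed.

Lemma quad_simple : simple v a.
Proof.
have pair z x : z.2 = 0 -> z.1 = x -> z = (x, 0).
  by move=> h1 h2; rewrite [z]surjective_pairing h1 h2.
have I := pi4_bounds; have I' : - pi < - (pi / 4 : R) < pi by lra.
have ne (x y : R) : x != y -> ((x, 0) : R * R) != (y, 0).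
  by apply: contra_neq => -[].
split.
  elim/I4_ind; rewrite nxt_inord4 // !quad_vertexE //= quad_bendE //=; split=> //;
    apply: ne; apply/eqP; lra.
suff W (i j : 'I_4) : (i < j)%N -> forall z, edge v a i z -> edge v a j z ->
    (j = nxt i /\ z = v j) \/ (i = nxt j /\ z = v i).
  move=> i j ij z zi zj; have := ij; rewrite -val_eqE neq_ltn => /orP[ltij|ltji].
    exact: W.
  by have := W _ _ ltji z zj zi; tauto.
elim/I4_ind: i; elim/I4_ind: j; rewrite ?inordK // => _ z;
  rewrite ?quad_edge0 ?quad_edge1 ?quad_edge2 ?quad_edge3;
  rewrite ?nxt_inord4 ?quad_vertexE //= => h1 h2.
- by left; split=> //; have [z2 [[e|e] [e'|e']]] := lower_arc_half_turn h1 h2; apply: pair => //; lra.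
- by exfalso; have [_ [[e|e] [e'|e']]] := lower_arc_half_turn h1 h2; lra.
- by right; split=> //; exact: lower_arc12.
- left; split=> //; rewrite -half0 -[z]half_turnK; congr half_turn; exact: lower_arc12.
- by exfalso; have [_ [[e|e] [e'|e']]] := lower_arc_half_turn h2 h1; lra.
- by left; split=> //; have [z2 [[e|e] [e'|e']]] := lower_arc_half_turn h2 h1; apply: pair => //; lra.
Qed.

(** * The two regions of the quadrilateral *)

Definition lower_lune z : Prop := z.2 <= 0 /\ lin z < sqn z < 2 * lin z.
(** Both halves contain the open segment from [(1, 0)] to [(2, 0)], which glues them together. *)
Definition quad_inside : set (R * R) := [set z | lower_lune z \/ lower_lune (half_turn z)].
Definition quad_outside : set (R * R) := [set z | ~ quad_inside z /\ ~ curve v a z].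

Lemma continuous_sqn : continuous sqn.
Proof.
move=> z; apply: (@continuousD _ R (R * R)%type (fun z => z.1 ^+ 2) (fun z => z.2 ^+ 2)).
  by apply: (@continuousM R _ fst fst); exact: cvg_fst.
by apply: (@continuousM R _ snd snd); exact: cvg_snd.
Qed.

Lemma continuous_lin : continuous lin.
Proof.
by move=> z; apply: (@continuousD _ R (R * R)%type fst snd); [exact: cvg_fst|exact: cvg_snd].
Qed.

Lemma closed_le_fun (f g : R * R -> R) : continuous f -> continuous g ->
  closed [set z | f z <= g z].
Proof.
move=> cf cg.
have -> : [set z | f z <= g z] = (fun z => g z - f z) @^-1` [set x | 0 <= x].
  by apply/seteqP; split=> z /=; rewrite subr_ge0.
apply: closed_comp; last exact: closed_ge.
by move=> z _; apply: (@continuousB _ R (R * R)%type g f); [exact: cg|exact: cf].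
Qed.

Lemma continuous_half_turn : continuous half_turn.
Proof.
apply: continuous_pair => z.
- by apply: (@continuousB _ R (R * R)%type (fun=> 3) fst); [exact: cst_continuous|exact: cvg_fst].
- by apply: (@continuousN _ R (R * R)%type snd); exact: cvg_snd.
Qed.

Lemma sqn_ge0 z : 0 <= sqn z.
Proof. by rewrite addr_ge0 // sqr_ge0. Qed.

Lemma closed_half_turn (K : set (R * R)) : closed K -> closed [set z | K z \/ K (half_turn z)].
Proof.
move=> cK; apply: (closedU cK (B := half_turn @^-1` K)).
by apply: closed_comp => // z _; exact: continuous_half_turn.
Qed.

Lemma lower_lune_axis z : lower_lune z -> z.2 = 0 -> 1 < z.1 < 2.
Proof. by rewrite /lower_lune /sqn /lin => -[_ /andP[h1 h2]] z2; rewrite z2 in h1 h2; nra. Qed.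

Lemma lower_lune_half_turn z : lower_lune z -> (half_turn z).2 <= 0 -> z.2 = 0 /\ 1 < z.1 < 2.
Proof.
move=> h; rewrite /half_turn /= => z2.
have z20 : z.2 = 0 by case: h => [h _]; lra.
by split=> //; exact: lower_lune_axis.
Qed.

Lemma quad_inside_half_turn z : quad_inside (half_turn z) <-> quad_inside z.
Proof. by rewrite /quad_inside /= half_turnK; tauto. Qed.

Lemma quad_curve_half_turn z : curve v a (half_turn z) <-> curve v a z.
Proof. by rewrite !quad_curveP half_turnK; tauto. Qed.

Lemma quad_outside_half_turn z : quad_outside (half_turn z) <-> quad_outside z.
Proof. by rewrite /quad_outside /= quad_inside_half_turn quad_curve_half_turn. Qed.

Lemma lower_lune_not_curve z : lower_lune z -> ~ curve v a z.
Proof.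
move=> h /quad_curveP[[[_ e]|[_ e]]|[k|k]].
- by case: h => _; rewrite e; lra.
- by case: h => _; rewrite e; lra.
- have [z2 x12] := lower_lune_half_turn h k.1.
  by have [e|e] := lower_arc_half_axis k z2; lra.
- have [z2 x12] := lower_lune_half_turn h k.1.
  by have [e|e] := lower_arc_half_axis k z2; lra.
Qed.

Lemma quad_inside_not_curve z : quad_inside z -> ~ curve v a z.
Proof.
move=> [/lower_lune_not_curve //|/lower_lune_not_curve h].
by rewrite -quad_curve_half_turn.
Qed.

Lemma outside_lower z : z.2 < 0 -> ~ (lin z <= sqn z <= 2 * lin z) -> quad_outside z.
Proof.
move=> z2 nL; have N0 := sqn_ge0 z.
have nh : ~ (half_turn z).2 <= 0 by rewrite /half_turn /=; lra.
split.
  move=> [[_ /andP[h1 h2]]|[//]].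
  by apply: nL; rewrite !ltW.
move=> /quad_curveP[[[_ e]|[_ e]]|[[//]|[//]]]; apply: nL; lra.
Qed.

Lemma outside_axis z : z.2 = 0 -> z.1 != 0 -> z.1 < 1 -> quad_outside z.
Proof.
move=> z2 z1n z11; split.
  move=> [/lower_lune_axis/(_ z2)|/lower_lune_axis]; first by lra.
  by rewrite /half_turn /= z2 oppr0 => /(_ erefl); lra.
have z1n' : z.1 <> 0 by apply/eqP.
move=> /quad_curveP[[k|k]|[k|k]].
- by have [//|e] := lower_arc_axis k z2; lra.
- by have [//|e] := lower_arc_axis k z2; lra.
- by have [e|e] := lower_arc_half_axis k z2; lra.
- by have [e|e] := lower_arc_half_axis k z2; lra.
Qed.

(** The half-turned point lies outside the larger circle: there [sqn - 2 lin] equals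
    [(3 - x) (1 - x) + y^2 + 2 y], where [z = (x, y)]. *)
Lemma outside_above z : 0 < z.2 -> z.1 < 1 -> quad_outside z.
Proof.
move=> z2 z1; apply/quad_outside_half_turn; apply: outside_lower; rewrite /half_turn /sqn /lin /=.
  by lra.
by nra.
Qed.

Lemma outside_cap z : z.2 <= 0 -> sqn z < lin z -> quad_outside z /\ 0 < z.1 < 1.
Proof.
move=> z2 h; have x01 : 0 < z.1 < 1.
  move: h; rewrite /sqn /lin => h; have := sqr_ge0 z.2 => h2.
  have h1 : z.1 * (z.1 - 1) < 0 by lra.
  by nra.
split=> //; have [z2'|z2'] := ltP z.2 0; first by apply: outside_lower => //; lra.
by apply: outside_axis; [lra|apply/eqP; lra|lra].
Qed.

(** By symmetry [z.2 <= 0]. Points within the small circle escape upwards, points beyond the large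
    one downwards, and the band between them belongs to the inside or the curve. *)
Lemma quad_escape z : quad_outside z -> escaping quad_outside z.
Proof.
wlog z2 : z / z.2 <= 0 => [W|].
  have [z2|z2] := leP z.2 0; first exact: W.
  move=> /quad_outside_half_turn h; have [|//|d [d0 Hd]] := W (half_turn z).
    by rewrite /half_turn /=; lra.
  exists (pscale (-1) d); split.
    move=> e; apply: d0; have : pscale (-1) (pscale (-1) d) = (0, 0).
      by rewrite e /pscale /= !mulr0.
    by rewrite pscaleA mulrNN mulr1 pscale1.
  move=> t t0; apply/quad_outside_half_turn; have := Hd t t0; congr quad_outside.
  by rewrite /half_turn /padd /pscale /=; congr (_, _); ring.
move=> Vz; have N0 := sqn_ge0 z.
have [NL|LN] := ltP (sqn z) (lin z).
  (* The abscissa is below 1, so the ray stays within the small circle up to the axis and is then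
     covered by [outside_above]. *)
  have [_ x01] := outside_cap z2 NL.
  exists (0, 1); split; first by move=> [/eqP]; rewrite oner_eq0.
  move=> t t0; set w := padd _ _.
  have [w2|w2] := leP w.2 0; last first.
    by apply: outside_above => //; rewrite /w /=; lra.
  suff /(outside_cap w2)[] : sqn w < lin w by [].
  move: NL w2; rewrite /w /sqn /lin /padd /pscale /= => NL w2; nra.
have [LN2|NL2] := ltP (2 * lin z) (sqn z).
  exists (0, -1); split; first by move=> [/eqP]; rewrite oppr_eq0 oner_eq0.
  move=> t t0; have [->|tn0] := eqVneq t 0.
    by rewrite /padd /pscale !mul0r !addr0 -surjective_pairing.
  have tp : 0 < t by rewrite lt_neqAle eq_sym tn0.
  apply: outside_lower; first by rewrite /padd /pscale /=; lra.
  by move: LN2; rewrite /padd /pscale /sqn /lin /= => LN2; nra.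
exfalso; case: Vz => nU nC.
have [e|e] := eqVneq (sqn z) (lin z).
  by apply: nC; apply/quad_curveP; left; left; split; rewrite ?mul1r.
have [e'|e'] := eqVneq (sqn z) (2 * lin z).
  by apply: nC; apply/quad_curveP; left; right; split.
apply: nU; left; split=> //.
by rewrite !lt_neqAle [lin z == _]eq_sym e e' LN NL2.
Qed.

(** Making the inequalities of the lunes non-strict adds exactly the four arcs, and closedness
    becomes visible. *)
Lemma quad_inside_closure :
  quad_inside `|` curve v a =
  [set z | (z.2 <= 0 /\ lin z <= sqn z <= 2 * lin z) \/
     ((half_turn z).2 <= 0 /\ lin (half_turn z) <= sqn (half_turn z) <= 2 * lin (half_turn z))].
Proof.
have one z : z.2 <= 0 -> lin z <= sqn z <= 2 * lin z -> quad_inside z \/ curve v a z.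
  move=> z2 /andP[LN NL2].
  have [e|e] := eqVneq (sqn z) (lin z).
    by right; apply/quad_curveP; left; left; split; rewrite ?mul1r.
  have [e'|e'] := eqVneq (sqn z) (2 * lin z).
    by right; apply/quad_curveP; left; right; split.
  left; left; split=> //.
  by rewrite !lt_neqAle [lin z == _]eq_sym e e' LN NL2.
apply/seteqP; split=> z /=.
  have N0 := sqn_ge0 z; have N0' := sqn_ge0 (half_turn z).
  move=> [[[z2 /andP[h1 h2]]|[z2 /andP[h1 h2]]]|/quad_curveP[[[z2 e]|[z2 e]]|[[z2 e]|[z2 e]]]].
  - by left; rewrite z2 !ltW.
  - by right; rewrite z2 !ltW.
  - by left; split=> //; lra.
  - by left; split=> //; lra.
  - by right; split=> //; lra.
  - by right; split=> //; lra.
move=> [[z2 h]|[z2 h]]; first exact: one.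
have := one (half_turn z) z2 h.
by rewrite quad_curve_half_turn quad_inside_half_turn.
Qed.

Lemma quad_outside_closure :
  quad_outside `|` curve v a =
  [set z | (z.2 <= 0 /\ (sqn z <= lin z \/ 2 * lin z <= sqn z)) \/
     ((half_turn z).2 <= 0 /\ (sqn (half_turn z) <= lin (half_turn z) \/
       2 * lin (half_turn z) <= sqn (half_turn z)))].
Proof.
have nU z : z.2 <= 0 -> (sqn z <= lin z \/ 2 * lin z <= sqn z) -> ~ quad_inside z.
  move=> z2 h [[_ k]|k]; first by lra.
  have := lower_lune_half_turn k; rewrite half_turnK => /(_ z2) [w2 x12].
  have z20 : z.2 = 0 by move: w2; rewrite /half_turn /=; lra.
  move: x12 h; rewrite /half_turn /sqn /lin z20 /= => x12 [h|h]; nra.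
apply/seteqP; split=> z /=; last first.
  move=> h; have {}h : ~ quad_inside z.
    case: h => [[z2 h]|[z2 h]]; first exact: nU.
    by rewrite -quad_inside_half_turn; exact: (nU (half_turn z)).
  by have [c|c] := pselect (curve v a z); [right|left].
move=> [[n1 _]|c].
  have [z2|z2] := leP z.2 0.
    left; split=> //; have [|h1] := leP (sqn z) (lin z); first by left.
    right; rewrite leNgt; apply/negP => h2; apply: n1; left; split=> //.
    by rewrite h1 h2.
  have w2 : (half_turn z).2 <= 0 by rewrite /half_turn /=; lra.
  right; split=> //; have [|h1] := leP (sqn (half_turn z)) (lin (half_turn z)); first by left.
  right; rewrite leNgt; apply/negP => h2; apply: n1; right; split=> //.
  by rewrite h1 h2.
move: c => /quad_curveP[[[z2 e]|[z2 e]]|[[z2 e]|[z2 e]]].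
- by left; split=> //; left; rewrite e mul1r.
- by left; split=> //; right; rewrite e.
- by right; split=> //; left; rewrite e mul1r.
- by right; split=> //; right; rewrite e.
Qed.

Lemma quad_regions :
  quad_inside `<=` interior_of v a /\ quad_outside `<=` exterior_of v a.
Proof.
have c2 : continuous (fun z => 2 * lin z).
  by move=> z; apply: (@continuousM R _ (fun=> 2) lin); [exact: cst_continuous|exact: continuous_lin].
have cs : continuous (@snd R R) by move=> z; exact: cvg_snd.
have c0 : continuous (fun _ : R * R => (0 : R)) by exact: cst_continuous.
apply: separated_components.
- move=> z; have [c|c] := pselect (curve v a z); first by right; left.
  by have [u|u] := pselect (quad_inside z); [left|right; right].
- by move=> z Uz; split; [exact: quad_inside_not_curve|case].
- by move=> z [].
- rewrite quad_inside_closure.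
  apply: (@closed_half_turn [set z | z.2 <= 0 /\ lin z <= sqn z <= 2 * lin z]).
  have -> : [set z | z.2 <= 0 /\ lin z <= sqn z <= 2 * lin z] =
    [set z | z.2 <= 0] `&` ([set z | lin z <= sqn z] `&` [set z | sqn z <= 2 * lin z]).
    by apply/seteqP; split=> z /=; [move=> [? /andP[]]|move=> [? [-> ->]]].
  by apply: closedI; [|apply: closedI]; apply: closed_le_fun => //;
    [exact: continuous_lin|exact: continuous_sqn|exact: continuous_sqn].
- rewrite quad_outside_closure.
  apply: (@closed_half_turn [set z | z.2 <= 0 /\ (sqn z <= lin z \/ 2 * lin z <= sqn z)]).
  have -> : [set z | z.2 <= 0 /\ (sqn z <= lin z \/ 2 * lin z <= sqn z)] =
    [set z | z.2 <= 0] `&` ([set z | sqn z <= lin z] `|` [set z | 2 * lin z <= sqn z]).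
    by apply/seteqP; split=> z.
  by apply: closedI; [|apply: closedU]; apply: closed_le_fun => //;
    [exact: continuous_sqn|exact: continuous_lin|exact: continuous_sqn].
(* Lower lunes have coordinates between -3 and 3; the half-turn moves the first one to between 0 and
   6. *)
- exists 6.
  have b z : lower_lune z -> -3 <= z.1 <= 3 /\ -3 <= z.2 <= 3.
    by move=> [z2 /andP[_]]; rewrite /sqn /lin => h; split; nra.
  by move=> z [/b[h1 h2]|/b[]]; rewrite ?/half_turn /= => *; rewrite !ler_norml; lra.
- exact: quad_escape.
Qed.

(** On a ray from the cusp [sqn] is [t^2] and [lin] is [t (d1 + d2)]. Both circles touch the line
    [d1 + d2 = 0], and [phi] excludes only their common tangent ray. *)
Lemma outside_near_cusp (phi : R) : 0 < phi < 2 * pi ->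
  exists2 e, 0 < e & forall t, 0 < t < e ->
    quad_outside (pscale t (dir (- (pi / 4) - phi))).
Proof.
move=> phiI; have s0 := sin_pi4_gt0.
have d1E : cos (- (pi / 4) - phi) = sin (pi / 4) * (cos phi - sin phi).
  by rewrite cosB cosN sinN cos_pi4; ring.
have d2E : sin (- (pi / 4) - phi) = - (sin (pi / 4) * (cos phi + sin phi)).
  by rewrite sinB cosN sinN cos_pi4; ring.
have cs := cos2Dsin2 (- (pi / 4) - phi).
have c1 := cos_le1 (- (pi / 4) - phi).
rewrite /dir; set d1 := cos _ in d1E cs c1 *; set d2 := sin (_ - phi) in d2E cs *.
have N t : sqn (pscale t (d1, d2)) = t ^+ 2.
  by rewrite /sqn /pscale /=; transitivity (t ^+ 2 * (d1 ^+ 2 + d2 ^+ 2)); [ring|rewrite cs mulr1].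
have L t : lin (pscale t (d1, d2)) = t * (d1 + d2) by rewrite /lin /pscale /=; ring.
have [d2n|d2p|d20] := ltgtP d2 0.
- have [sn|sp|s00] := ltgtP (d1 + d2) 0.
  + exists 1; first exact: ltr01.
    move=> t /andP[t0 t1]; apply: outside_lower; first by rewrite /pscale /=; nra.
    by rewrite N L; nra.
  (* Up to this bound [t^2 < t (d1 + d2)]: the point is within the small circle. *)
  + exists (d1 + d2) => // t /andP[t0 t1]; apply: outside_lower.
      by rewrite /pscale /=; nra.
    by rewrite N L; nra.
  + have sphi : sin phi = 0.
      have : sin (pi / 4) * sin phi = 0 by lra.
      by move/eqP; rewrite mulf_eq0 gt_eqF //= => /eqP.
    have cphi : 0 < cos phi.
      by rewrite -(pmulr_rgt0 _ s0); move: d2E; rewrite sphi; lra.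
    have phiI' : 0 <= phi <= 2 * pi by lra.
    by have [e|e] := sin_eq0_2pi phiI' sphi cphi; lra.
- exists 1; first exact: ltr01.
  by move=> t /andP[t0 t1]; apply: outside_above; rewrite /pscale /=; nra.
- exists 1; first exact: ltr01.
  move=> t /andP[t0 t1]; apply: outside_axis; rewrite /pscale /= ?d20 ?mulr0 //; last by nra.
  apply: mulf_neq0; first by rewrite gt_eqF.
  by apply/eqP => d10; move: cs; rewrite d10 d20; lra.
Qed.

(** With [(d1, d2)] the direction at angle [pi / 4 - phi], at distance [t] from [(1, 0)] one has
    [sqn - lin = t (d1 - d2) + t^2], so the sign of this difference tells the sides of the tangent
    apart. *)
Lemma near_inflection_diff (phi : R) :
  cos (pi / 4 - phi) - sin (pi / 4 - phi) = 2 * sin (pi / 4) * sin phi.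
Proof. by rewrite cosB sinB cos_pi4; ring. Qed.

Lemma inside_near_inflection (phi : R) : 0 < phi < pi ->
  exists2 e, 0 < e & forall t, 0 < t < e ->
    quad_inside (padd (1, 0) (pscale t (dir (pi / 4 - phi)))).
Proof.
move=> phiI; have s0 := sin_pi4_gt0; have sp := sin_gt0_pi phiI.
have gE := near_inflection_diff phi.
have g0 : 0 < 2 * sin (pi / 4) * sin phi by rewrite !mulr_gt0.
have cs := cos2Dsin2 (pi / 4 - phi).
have c1 := cos_le1 (pi / 4 - phi); have s1 := sin_geN1 (pi / 4 - phi).
rewrite /dir; set d1 := cos _ in gE cs c1 *; set d2 := sin (_ - phi) in gE cs s1 *.
set g := 2 * _ * _ in gE g0.
(* [1 / 4] keeps the circle not passing through [(1, 0)] out of reach. [g] serves above the axis,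
   where after the half-turn [sqn - 2 lin = t^2 - 2 t g]. *)
exists (Num.min (1 / 4) g); first by rewrite lt_min g0 andbT; lra.
move=> t; rewrite lt_min => /andP[t0 /andP[t4 tg]].
have t2 : t ^+ 2 * (d1 ^+ 2 + d2 ^+ 2) = t ^+ 2 by rewrite cs mulr1.
have td1 : t * d1 <= t by rewrite ger_pMr.
have td2 : - t <= t * d2 by nra.
have tg2 : t * (d1 - d2) = t * g by rewrite gE.
have [d20|d20] := leP d2 0; [left|right]; split; rewrite /half_turn /sqn /lin /padd /pscale /=.
- by nra.
- by apply/andP; split; nra.
- by nra.
- by apply/andP; split; nra.
Qed.

Lemma outside_near_inflection (phi : R) : pi < phi < 2 * pi ->
  exists2 e, 0 < e & forall t, 0 < t < e ->
    quad_outside (padd (1, 0) (pscale t (dir (pi / 4 - phi)))).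
Proof.
move=> phiI; have s0 := sin_pi4_gt0.
have sp : sin phi < 0.
  have -> : phi = (phi - pi) + pi by ring.
  by rewrite sinDpi oppr_lt0; apply: sin_gt0_pi; lra.
have gE := near_inflection_diff phi.
have g0 : 2 * sin (pi / 4) * sin phi < 0 by rewrite nmulr_llt0 // mulr_gt0.
have cs := cos2Dsin2 (pi / 4 - phi).
rewrite /dir; set d1 := cos _ in gE cs *; set d2 := sin (_ - phi) in gE cs *.
set g := 2 * _ * _ in gE g0.
(* This makes [sqn - lin = t (g + t)] negative for rays below the axis; above it, [t^2 - 2 t g] is
   positive anyway. *)
exists (- g); first by rewrite oppr_gt0.
move=> t /andP[t0 tg].
have t2 : t ^+ 2 * (d1 ^+ 2 + d2 ^+ 2) = t ^+ 2 by rewrite cs mulr1.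
have tg2 : t * (d1 - d2) = t * g by rewrite gE.
have tgn : t * (g + t) < 0 by nra.
have [d20|d20] := leP d2 0.
  suff [] : quad_outside (padd (1, 0) (pscale t (d1, d2))) /\
     0 < (padd (1, 0) (pscale t (d1, d2))).1 < 1 by [].
  apply: outside_cap; rewrite /sqn /lin /padd /pscale /=; nra.
apply/quad_outside_half_turn; apply: outside_lower;
  rewrite /half_turn /sqn /lin /padd /pscale /=; first by nra.
move=> /andP[_]; nra.
Qed.

Let rot_axis (b k : R) : rot b (k, 0) = pscale k (dir b).
Proof. by rewrite /rot /pscale /dir /=; congr (_, _); ring. Qed.

Lemma half_turn_padd w z : half_turn (padd w z) = padd (half_turn w) (pscale (-1) z).
Proof. by rewrite /half_turn /padd /pscale /=; congr (_, _); ring. Qed.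

(** [k = -1] transports the cusp at [(3, 0)] to the origin by the half-turn. The two tangents
    coincide, so only the exterior condition has content. *)
Lemma quad_angle_cusp (i : 'I_4) (k m m' : R) : 0 < m -> 0 < m' ->
  k = 1 /\ v i = (0, 0) \/ k = -1 /\ v i = (3, 0) ->
  tan_out v a i = pscale (k * m) (dir (- (pi / 4))) ->
  tan_in v a i = pscale (k * m') (dir (- (pi / 4))) ->
  interior_angle v a i 0.
Proof.
move=> m0 m'0 kv out inn; have pi0 := pi_gt0 R.
have [_ outV] := quad_regions.
split; first by rewrite lexx; lra.
exists (-1); split; first by right.
split; [|split].
- exists (m / m'); split; first exact: divr_gt0.
  rewrite out inn rot_pscale_dir pscaleA mulr0 add0r; congr (pscale _ _).
  by field; rewrite gt_eqF.
- by move=> phi; lra.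
- move=> phi phiI; have [e e0 He] := outside_near_cusp phiI.
  exists (e / m); split; first exact: divr_gt0.
  move=> t /andP[t0]; rewrite ltr_pdivlMr // => te; apply: outV.
  have /He : 0 < t * m < e by rewrite te mulr_gt0.
  rewrite out rot_pscale_dir pscaleA mulN1r [- phi + _]addrC.
  move: kv => [[-> ->]|[-> ->]].
    rewrite mul1r; congr quad_outside.
    by rewrite /padd /=; rewrite !add0r.
  rewrite -quad_outside_half_turn -half0; congr quad_outside.
  by rewrite /half_turn /padd /pscale /=; congr (_, _); ring.
Qed.

(** The crescent lies to the right of its oriented boundary, whence the sense -1; [k = -1] is again
    the half-turned vertex. *)
Lemma quad_angle_inflection (i : 'I_4) (k m m' : R) : 0 < m -> 0 < m' ->
  k = 1 /\ v i = (1, 0) \/ k = -1 /\ v i = (2, 0) ->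
  tan_out v a i = pscale (k * m) (dir (pi / 4)) ->
  tan_in v a i = pscale (- (k * m')) (dir (pi / 4)) ->
  interior_angle v a i pi.
Proof.
move=> m0 m'0 kv out inn; have pi0 := pi_gt0 R.
have [inU outV] := quad_regions.
have ray (P : set (R * R)) (phi : R) : (forall z, P (half_turn z) <-> P z) ->
    (exists2 e, 0 < e & forall t, 0 < t < e ->
       P (padd (1, 0) (pscale t (dir (pi / 4 - phi))))) ->
    exists eps, 0 < eps /\ forall t, 0 < t < eps ->
      P (padd (v i) (pscale t (rot (-1 * phi) (tan_out v a i)))).
  move=> PK [e e0 He]; exists (e / m); split; first exact: divr_gt0.
  move=> t /andP[t0]; rewrite ltr_pdivlMr // => te.
  have /He : 0 < t * m < e by rewrite te mulr_gt0.
  rewrite out rot_pscale_dir pscaleA mulN1r [- phi + _]addrC.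
  move: kv => [[-> ->]|[-> ->]]; first by rewrite mul1r.
  rewrite -PK half_turn_padd half1 pscaleA; congr P.
  by congr (padd _ (pscale _ _)); ring.
split; first by lra.
exists (-1); split; first by right.
split; [|split].
- exists (m / m'); split; first exact: divr_gt0.
  rewrite out inn rot_pscale_dir pscaleA mulN1r [- _ + _]addrC.
  have -> : dir (pi / 4 - pi : R) = pscale (-1) (dir (pi / 4)).
    by have := dirDpi (pi / 4 - pi : R); rewrite subrK => ->; rewrite pscaleA mulrNN mulr1 pscale1.
  rewrite pscaleA; congr (pscale _ _).
  by field; rewrite gt_eqF.
- move=> phi phiI.
  have [e [e0 He]] := ray _ phi quad_inside_half_turn (inside_near_inflection phiI).
  by exists e; split=> // t tI; apply: inU; exact: He.
- move=> phi phiI.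
  have [e [e0 He]] := ray _ phi quad_outside_half_turn (outside_near_inflection phiI).
  by exists e; split=> // t tI; apply: outV; exact: He.
Qed.

Lemma quad_angles (i : 'I_4) : interior_angle v a i (if odd i then pi else 0).
Proof.
have two : 0 < 2 :> R by exact: ltr0n.
elim/I4_ind: i; rewrite inordK //=.
- apply: (@quad_angle_cusp _ 1 1 2) => //.
  + by left; rewrite quad_vertexE.
  + rewrite /tan_out nxt_inord4 // !quad_vertexE // quad_bendE //= /psub /= subr0 subrr.
    by rewrite rot_axis; congr pscale; ring.
  + rewrite /tan_in prv_inord4 // !quad_vertexE // quad_bendE //= /psub /= subrr.
    by rewrite rot_axis pscaleA; congr pscale; ring.
- apply: (@quad_angle_inflection _ 1 2 1) => //.
  + by left; rewrite quad_vertexE.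
  + rewrite /tan_out nxt_inord4 // !quad_vertexE // quad_bendE //= /psub /= subrr opprK.
    by rewrite rot_axis; congr pscale; ring.
  + rewrite /tan_in prv_inord4 // !quad_vertexE // quad_bendE //= /psub /= subrr.
    by rewrite rot_axis pscaleA; congr pscale; ring.
- apply: (@quad_angle_cusp _ (-1) 1 2) => //.
  + by right; rewrite quad_vertexE.
  + rewrite /tan_out nxt_inord4 // !quad_vertexE // quad_bendE //= /psub /= subrr.
    by rewrite rot_axis; congr pscale; ring.
  + rewrite /tan_in prv_inord4 // !quad_vertexE // quad_bendE //= /psub /= subrr.
    by rewrite rot_axis pscaleA; congr pscale; ring.
- apply: (@quad_angle_inflection _ (-1) 2 1) => //.
  + by right; rewrite quad_vertexE.
  + rewrite /tan_out nxt_inord4 // !quad_vertexE // quad_bendE //= /psub /= subrr opprK.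
    by rewrite rot_axis; congr pscale; ring.
  + rewrite /tan_in prv_inord4 // !quad_vertexE // quad_bendE //= /psub /= subrr.
    by rewrite rot_axis pscaleA; congr pscale; ring.
Qed.

Lemma realizable_alternating (theta : 'I_4 -> R) :
  (forall i, theta i = if odd i then pi else 0) -> realizable theta.
Proof.
move=> E; exists v, a; split; first exact: quad_simple.
by move=> i; rewrite E; exact: quad_angles.
Qed.

End Quadrilateral.

(** * Choosing the splitting *)

Section Assembly.
Variable R : realType.

Lemma sum_nxt n (F : 'I_n -> R) : \sum_i F (nxt i) = \sum_i F i.
Proof.
rewrite [RHS](reindex (@nxt n)) //; apply: onW_bij; exact: ordS_bij.
Qed.

(** Equal sums of [p] and [q] mean that the tilts [d] cancel. The last bound says that the maximal
    half-widths of the sectors add up to more than [pi]. *)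
Lemma realizable_split n (theta p q : 'I_n -> R) : (1 < n)%N ->
  (forall i, [/\ 0 <= p i, 0 <= q i, p i + q i = theta i & theta i <= pi]) ->
  \sum_i p i = \sum_i q i ->
  (forall i, `|p i - q (nxt i)| < pi) ->
  \sum_i `|p i - q (nxt i)| < n%:R * pi - 2 * pi ->
  realizable theta.
Proof.
move=> n1 pq spq sm ssum.
pose d i := (p i - q (nxt i)) / 2.
have nd i : `|d i| = `|p i - q (nxt i)| / 2.
  by rewrite /d normrM [`|2^-1|]ger0_norm // invr_ge0.
have d_small i : `|d i| < pi / 2 by rewrite nd; have := sm i; lra.
have sum_d : \sum_i d i = 0.
  by rewrite -mulr_suml sumrB sum_nxt spq subrr mul0r.
have sum_M : pi < \sum_i (pi / 2 - `|d i|).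
  rewrite sumrB sumr_const card_ord -[_ *+ n]mulr_natl.
  rewrite (eq_bigr (fun i => `|p i - q (nxt i)| / 2)) => [|i _]; last exact: nd.
  by rewrite -mulr_suml; lra.
have [c [c0 cd sc bal]] := balanced_sectors d_small sum_d sum_M.
have p0 i : 0 <= p i by have [] := pq i.
have q0 i : 0 <= q i by have [] := pq i.
have pql i : p i + q i <= pi by have [_ _ ->] := pq i.
exists (star_vertex p q c), (star_bend p q c); split.
  exact: star_simple.
move=> i; have [_ _ <- _] := pq i.
exact: star_interior_angle.
Qed.

Lemma realizable_bisect n (theta : 'I_n -> R) : (1 < n)%N ->
  (forall i, 0 <= theta i <= pi) ->
  \sum_i `|theta i - theta (nxt i)| < 2 * (n%:R * pi - 2 * pi) ->
  realizable theta.
Proof.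
move=> n1 tI ssum; have pi0 := pi_gt0 R.
have nd i : `|theta i / 2 - theta (nxt i) / 2| = `|theta i - theta (nxt i)| / 2.
  by rewrite -mulrBl normrM [`|2^-1|]ger0_norm // invr_ge0.
apply: (@realizable_split _ _ (fun i => theta i / 2) (fun i => theta i / 2)) => //.
- by move=> i; have := tI i; split; lra.
- move=> i; rewrite nd; have := tI i; have := tI (nxt i) => h1 h2.
  suff : `|theta i - theta (nxt i)| <= pi by lra.
  by rewrite ler_norml; lra.
- under eq_bigr do rewrite nd.
  by rewrite -mulr_suml; lra.
Qed.

Lemma norm_diff_le (theta : R) (theta' : R) : 0 <= theta <= pi -> 0 <= theta' <= pi ->
  `|theta - theta'| <= pi.
Proof. by move=> h1 h2; rewrite ler_norml; lra. Qed.

Lemma norm_diff_eq (x y : R) : 0 <= x <= pi -> 0 <= y <= pi -> pi <= `|x - y| ->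
  (x = 0 /\ y = pi) \/ (x = pi /\ y = 0).
Proof.
move=> h1 h2; have [xy|xy] := ler0P (x - y) => h3; [left|right]; split; lra.
Qed.

(** The [n] differences are at most [pi] each, and [n pi < 2 (n - 2) pi] as soon as [n > 4]. *)
Lemma realizable_ge5 n (theta : 'I_n -> R) : (5 <= n)%N ->
  (forall i, 0 <= theta i <= pi) -> realizable theta.
Proof.
move=> n5 tI; have pi0 := pi_gt0 R.
apply: realizable_bisect => //; first by lia.
have h : \sum_i `|theta i - theta (nxt i)| <= n%:R * pi.
  apply: le_trans (ler_sum _ (fun i _ => norm_diff_le (tI i) (tI (nxt i)))) _.
  by rewrite sumr_const card_ord mulr_natl.
have n5R : (5 : R) <= n%:R by rewrite (ler_nat R 5 n).
have h5 : 5 * pi <= n%:R * pi :> R by rewrite ler_pM2r.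
by lra.
Qed.

(** Four differences reach the critical total [4 pi] only if each equals [pi], that is, if the
    angles alternate between 0 and [pi]. *)
Lemma realizable_4 (theta : 'I_4 -> R) : (forall i, 0 <= theta i <= pi) -> realizable theta.
Proof.
move=> tI; have pi0 := pi_gt0 R.
have [[i0 hi0]|nex] := pselect (exists i, `|theta i - theta (nxt i)| < pi).
  apply: realizable_bisect => //.
  rewrite (bigD1 i0) //=.
  have h : \sum_(i < 4 | i != i0) `|theta i - theta (nxt i)| <= 3 * pi.
    apply: le_trans (ler_sum _ (fun i _ => norm_diff_le (tI i) (tI (nxt i)))) _.
    by rewrite sumr_const cardC1 card_ord mulr_natl.
  by lra.
have alt i : (theta i = 0 /\ theta (nxt i) = pi) \/ (theta i = pi /\ theta (nxt i) = 0).
  apply: norm_diff_eq => //.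
  by rewrite leNgt; apply/negP => h; apply: nex; exists i.
have n0 : nxt (inord 0 : 'I_4) = inord 1 by rewrite nxt_inord4.
have n1 : nxt (inord 1 : 'I_4) = inord 2 by rewrite nxt_inord4.
have n2 : nxt (inord 2 : 'I_4) = inord 3 by rewrite nxt_inord4.
have a0 := alt (inord 0); have a1 := alt (inord 1); have a2 := alt (inord 2).
rewrite n0 in a0; rewrite n1 in a1; rewrite n2 in a2.
case: a0 => [[e0 e1]|[e0 e1]].
  apply: realizable_alternating; elim/I4_ind; rewrite inordK //=.
  - by case: a1 => [[e1' e2]|[_ e2]] //; lra.
  - by case: a2 => [[e2 e3]|[e2 e3]] //; case: a1 => [[e1' e2']|[e1' e2']]; lra.
have -> : theta = (fun i : 'I_4 => if odd i then pi else 0) \o @nxt 4.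
  apply/funext; elim/I4_ind; rewrite /= !inordK //=.
  - by case: a1 => [[_ e2]|[e1' e2]] //; lra.
  - by case: a2 => [[e2 e3]|[e2 e3]] //; case: a1 => [[e1' e2']|[e1' e2']]; lra.
by apply: realizable_nxt; exact: realizable_alternating.
Qed.

(** * Triangles *)

Lemma nxt_inord3 k : (k < 3)%N -> nxt (inord k : 'I_3) = inord (k.+1 %% 3).
Proof. by move=> k3; apply: val_inj; rewrite /= !inordK // ltn_mod. Qed.

Lemma I3_ind (P : 'I_3 -> Prop) : P (inord 0) -> P (inord 1) -> P (inord 2) -> forall i, P i.
Proof.
move=> P0 P1 P2 i; rewrite -(inord_val i).
by case: i => [[|[|[|//]]] ?].
Qed.

Lemma inord3E : ((inord 0 : 'I_3) = ord0) * ((inord 1 : 'I_3) = lift ord0 ord0) *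
  ((inord 2 : 'I_3) = lift ord0 (lift ord0 ord0)).
Proof. by split; [split|]; apply: val_inj; rewrite /= inordK. Qed.

Lemma sum_I3 (F : 'I_3 -> R) i : \sum_j F j = F i + F (nxt i) + F (nxt (nxt i)).
Proof.
have -> : \sum_j F j = F (inord 0) + F (inord 1) + F (inord 2).
  by rewrite !big_ord_recl big_ord0 !inord3E; ring.
by elim/I3_ind: i; rewrite !nxt_inord3 //=; ring.
Qed.

Lemma perm_I3 (F : 'I_3 -> R) i :
  perm_eq [seq F j | j <- enum 'I_3] [:: F i; F (nxt i); F (nxt (nxt i))].
Proof.
have -> : [seq F j | j <- enum 'I_3] = [:: F (inord 0); F (inord 1); F (inord 2)].
  rewrite (_ : enum 'I_3 = [:: inord 0; inord 1; inord 2]) //.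
  by apply: (inj_map val_inj); rewrite val_enum_ord /= !inordK.
elim/I3_ind: i; rewrite !nxt_inord3 //=; rewrite perm_sym; apply/permPl.
- exact: (perm_rot 1 [:: F (inord 0); F (inord 1); F (inord 2)]).
- exact: (perm_rot 2 [:: F (inord 0); F (inord 1); F (inord 2)]).
Qed.

Lemma I3_from i (P : 'I_3 -> Prop) : P i -> P (nxt i) -> P (nxt (nxt i)) -> forall j, P j.
Proof.
move=> P0 P1 P2; elim/I3_ind; move: P0 P1 P2; elim/I3_ind: i;
  by rewrite !nxt_inord3.
Qed.

Lemma nxt3 (i : 'I_3) : nxt (nxt (nxt i)) = i.
Proof. by elim/I3_ind: i; rewrite !nxt_inord3. Qed.

(* This case lets the angle at one vertex be split unequally, as needed when both
   0 and pi occur: bisection then gives degenerate sectors. *)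
Lemma realizable_3_split (i : 'I_3) (theta : 'I_3 -> R) (p0 p1 p2 q0 q1 q2 : R) :
  [/\ 0 <= p0, 0 <= p1 & 0 <= p2] -> [/\ 0 <= q0, 0 <= q1 & 0 <= q2] ->
  [/\ p0 + q0 = theta i, p1 + q1 = theta (nxt i) & p2 + q2 = theta (nxt (nxt i))] ->
  (forall j, theta j <= pi) ->
  p0 + p1 + p2 = q0 + q1 + q2 ->
  `|p0 - q1| + `|p1 - q2| + `|p2 - q0| < pi ->
  realizable theta.
Proof.
move=> [p00 p10 p20] [q00 q10 q20] [t0 t1 t2] tpi spq sd.
pose f (x y z : R) (j : 'I_3) := if j == i then x else if j == nxt i then y else z.
have f0 x y z : f x y z i = x by rewrite /f eqxx.
have f1 x y z : f x y z (nxt i) = y.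
  by rewrite /f eqxx ifN // nxt_neq.
have f2 x y z : f x y z (nxt (nxt i)) = z.
  rewrite /f ifN; last first.
    apply/eqP => /(congr1 (@nxt 3)); rewrite nxt3 => /esym/eqP.
    by rewrite (negbTE (nxt_neq _ _)).
  by rewrite ifN // nxt_neq.
have ssum : \sum_j `|f p0 p1 p2 j - f q0 q1 q2 (nxt j)| < pi.
  by rewrite (sum_I3 _ i) nxt3 !f0 !f1 !f2.
apply: (@realizable_split _ _ (f p0 p1 p2) (f q0 q1 q2)) => //.
- by apply: (I3_from (i := i)); rewrite ?f0 ?f1 ?f2; split.
- by rewrite !(sum_I3 _ i) !f0 !f1 !f2.
- move=> j; apply: le_lt_trans ssum.
  by rewrite (bigD1 j) //= lerDl sumr_ge0.
- by have := pi_gt0 R; lra.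
Qed.

Lemma realizable_3 (theta : 'I_3 -> R) : (forall i, 0 <= theta i <= pi) ->
  ~ perm_eq [seq theta i | i <- enum 'I_3] [:: 0; 0; pi] -> realizable theta.
Proof.
move=> tI np; have pi0 := pi_gt0 R.
have tpi i : theta i <= pi by have /andP[] := tI i.
have np' i : ~ perm_eq [:: theta i; theta (nxt i); theta (nxt (nxt i))] [:: 0; 0; pi].
  by move=> h; apply: np; apply: perm_trans h; exact: perm_I3.
have [[i hi]|nex] := pselect (exists i, pi <= `|theta i - theta (nxt i)|); last first.
  have lt i : `|theta i - theta (nxt i)| < pi.
    by rewrite ltNge; apply/negP => h; apply: nex; exists i.
  apply: realizable_bisect => //; rewrite (sum_I3 _ ord0).
  have := lt ord0; have := lt (nxt ord0); have := lt (nxt (nxt ord0)); rewrite nxt3.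
  move: (theta ord0) (theta (nxt ord0)) (theta (nxt (nxt ord0))) => x y z.
  (* The three cyclic differences add up to twice the largest, which is below [pi]. *)
  by case: (ler0P (x - y)); case: (ler0P (y - z)); case: (ler0P (z - x)) => *; lra.
have tx := tI (nxt (nxt i)); have npi := np' i.
(* Two angles are 0 and [pi]; a third angle 0 would give the excluded sequence. *)
have x0 : theta (nxt (nxt i)) != 0.
  apply/eqP => e; apply: npi; rewrite e.
  have [[-> ->]|[-> ->]] := norm_diff_eq (tI i) (tI (nxt i)) hi; apply/permPl.
    exact: (perm_rot 1 [:: 0; 0; pi]).
  exact: (perm_rot 2 [:: 0; 0; pi]).
have xp : 0 < theta (nxt (nxt i)) by rewrite lt_neqAle eq_sym x0; case/andP: tx.
set x := theta (nxt (nxt i)) in tx xp *.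
have ab (u : R) : 0 <= u -> `|u| = u by exact: ger0_norm.
have nab (u : R) : u <= 0 -> `|u| = - u by exact: ler0_norm.
have [[e0 e1]|[e0 e1]] := norm_diff_eq (tI i) (tI (nxt i)) hi.
  (* For the angles (0, pi, x) the angle [x] goes entirely to one side and [pi] is split so that the
     sums agree. The differences then total [pi - x], which is below [pi] because [x > 0]. *)
  apply: (@realizable_3_split i theta 0 ((x + pi) / 2) 0 0 ((pi - x) / 2) x) => //.
  - by split=> //; lra.
  - by split=> //; lra.
  - by rewrite e0 e1 -/x; split; lra.
  - by lra.
  - by rewrite (nab (0 - _)) ?(ab ((x + pi) / 2 - x)) ?subrr ?normr0; lra.
(* The mirror image of the previous splitting, for the angles (pi, 0, x). *)
apply: (@realizable_3_split i theta ((pi - x) / 2) 0 x ((x + pi) / 2) 0 0) => //.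
- by split=> //; lra.
- by split=> //; lra.
- by rewrite e0 e1 -/x; split; lra.
- by lra.
- by rewrite (nab (x - _)) ?(ab ((pi - x) / 2 - 0)) ?subrr ?normr0; lra.
Qed.

End Assembly.

Theorem mainTheorem8 (R : realType) (n : nat) (theta : 'I_n -> R) :
  (3 <= n)%N ->
  (forall i, 0 <= theta i <= pi) ->
  ~ (n = 3%N /\ perm_eq [seq theta i | i <- enum 'I_n] [:: 0; 0; pi]) ->
  exists (v : 'I_n -> R * R) (a : 'I_n -> R),
    simple v a /\ forall i, interior_angle v a i (theta i).
Proof.
move=> n3 tI np; rewrite -/(realizable theta).
case: n theta n3 tI np => [|[|[|[|[|n]]]]] // theta _ tI np.
- by apply: realizable_3 => // h; apply: np.
- exact: realizable_4.
- exact: realizable_ge5.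
Qed.
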